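(* Let $\Omega$ be a mixing basic set of an Axiom A diffeomorphism $f$. Then $f|_\Omega$ has the specification property with periodic specification: for every $\varepsilon>0$ there is $N(\varepsilon)\in\mathbb{N}$ such that for any finite collection of orbit segments $(x_1,[a_1,b_1]),\dots,(x_k,[a_k,b_k])$ with $x_j\in\Omega$ and $a_{j+1}-b_j\ge N(\varepsilon)$ for $j=1,\dots,k-1$, there exists $x\in\Omega$ with $$d(f^{a_j+i}(x),f^i(x_j))<\varepsilon\quad\text{for } i\in[0,b_j-a_j],\ j=1,\dots,k,$$ and the point $x$ can be chosen to be periodic.
   Context: A compact $f$-invariant set is hyperbolic if there is a continuous $Df$-invariant splitting $E^s\oplus E^u$ of the tangent bundle over it and constants $c>0,\lambda\in(0,1)$ with $\|Df^n_xv\|\le c\lambda^n\|v\|$ for $v\in E^s_x$ and $\|Df^{-n}_xv\|\le c\lambda^n\|v\|$ for $v\in E^u_x$, $n\ge0$. A $C^r$ diffeomorphism ($r\ge1$) of a compact Riemannian manifold satisfies Axiom A if its nonwandering set $\Omega(f)$ is hyperbolic and periodic points are dense in it. Basic sets are the members of the unique finite decomposition of $\Omega(f)$ into pairwise disjoint closed $f$-invariant sets on which $f$ is topologically transitive (each further being a finite disjoint union of closed sets cyclically permuted by $f$ on which the return power of $f$ is topologically mixing). A basic set $\Omega$ is mixing if $f|_\Omega$ is topologically mixing. In an orbit segment $(x_j,[a_j,b_j])$, $a_j\le b_j$ are integers. *)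

(* Defs.v *)
From HB Require Import structures.
From mathcomp Require Import all_boot all_order all_algebra.
From mathcomp Require Import all_classical all_reals all_analysis.

Set Implicit Arguments.
Unset Strict Implicit.
Unset Printing Implicit Defensive.

Import Order.TTheory GRing.Theory Num.Theory.
Import numFieldNormedType.Exports.

Local Open Scope classical_set_scope.
Local Open Scope ring_scope.

(* C^r on the open set U.  In finite dimension Dh is C^r as an operator-valued
   map iff x |-> Dh(x)v is C^r for every fixed v. *)
Fixpoint Cr (R : realType) (V W : normedModType R) (r : nat) (U : set V)
    (h : V -> W) : Prop :=
  match r with
  | 0 => forall x, U x -> {for x, continuous h}
  | r'.+1 => (forall x, U x -> differentiable h x) /\
             (forall v, Cr r' U (fun x => 'd h x v))
  end.

Definition Csmooth (R : realType) (V W : normedModType R) (U : set V)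
  (h : V -> W) : Prop := forall r, Cr r U h.

(* [cfun] and [cinv] are total; only their values on [cdom], resp. [ccod],
   are meaningful. *)
Record chart (R : realType) (n : nat) (M : topologicalType) := Chart {
  cdom : set M;
  ccod : set 'rV[R]_n;
  cfun : M -> 'rV[R]_n;
  cinv : 'rV[R]_n -> M;
  cdom_open : open cdom;
  ccod_open : open ccod;
  cfun_cod : forall x, cdom x -> ccod (cfun x);
  cinv_dom : forall z, ccod z -> cdom (cinv z);
  cfunK : forall x, cdom x -> cinv (cfun x) = x;
  cinvK : forall z, ccod z -> cfun (cinv z) = z;
  cfun_continuous : forall x, cdom x -> {for x, continuous cfun};
  cinv_continuous : forall z, ccod z -> {for z, continuous cinv} }.

(* Boundaryless smooth n-manifold structure on M.  The preferred chart
   [chart_at x] identifies the tangent space T_x M with 'rV[R]_n: a vector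
   v : 'rV[R]_n, seen as an element of T_x M, is always written in the
   coordinates of [chart_at x]. *)
Record manifold (R : realType) (n : nat) (M : topologicalType) := Manifold {
  atlas : set (chart R n M);
  chart_at : M -> chart R n M;
  chart_at_atlas : forall x, atlas (chart_at x);
  chart_at_dom : forall x, cdom (chart_at x) x;
  transition_smooth : forall c c', atlas c -> atlas c' ->
    Csmooth (ccod c `&` cinv c @^-1` cdom c') (cfun c' \o cinv c);
  manifold_hausdorff : hausdorff_space M;
  manifold_second_countable : @second_countable M }.

Definition Cr_map (R : realType) (n : nat) (M : topologicalType)
    (S : manifold R n M) (r : nat) (f : M -> M) : Prop :=
  continuous f /\
  forall c c', atlas S c -> atlas S c' ->
    Cr r (ccod c `&` (f \o cinv c) @^-1` cdom c') (cfun c' \o f \o cinv c).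

Record diffeo (R : realType) (n : nat) (M : topologicalType)
    (S : manifold R n M) (r : nat) := Diffeo {
  dfun :> M -> M;
  dinv : M -> M;
  dfunK : cancel dfun dinv;
  dinvK : cancel dinv dfun;
  dfun_Cr : Cr_map S r dfun;
  dinv_Cr : Cr_map S r dinv }.

Definition iterz (R : realType) (n : nat) (M : topologicalType)
    (S : manifold R n M) (r : nat) (f : diffeo S r) (m : int) : M -> M :=
  match m with
  | Posz k => iter k f
  | Negz k => iter k.+1 (dinv f)
  end.

(* The differential T_x M -> T_(f x) M. *)
Definition tangent_map (R : realType) (n : nat) (M : topologicalType)
    (S : manifold R n M) (f : M -> M) (x : M) (v : 'rV[R]_n) : 'rV[R]_n :=
  'd (cfun (chart_at S (f x)) \o f \o cinv (chart_at S x))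
     (cfun (chart_at S x) x) v.

(* The element of T_x M whose coordinates in the chart c are v. *)
Definition from_chart (R : realType) (n : nat) (M : topologicalType)
    (S : manifold R n M) (c : chart R n M) (x : M) (v : 'rV[R]_n) : 'rV[R]_n :=
  'd (cfun (chart_at S x) \o cinv c) (cfun c x) v.

Record riemannian (R : realType) (n : nat) (M : topologicalType)
    (S : manifold R n M) := Riemannian {
  inner : M -> 'rV[R]_n -> 'rV[R]_n -> R;
  inner_linear : forall x u, scalar (inner x u);
  inner_sym : forall x u v, inner x u v = inner x v u;
  inner_pos : forall x u, u != 0 -> 0 < inner x u u;
  inner_smooth : forall c, atlas S c -> forall u v,
    @Csmooth R 'rV[R]_n R (ccod c) (fun z =>
      inner (cinv c z) (from_chart S c (cinv c z) u)
                       (from_chart S c (cinv c z) v)) }.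

Definition tnorm (R : realType) (n : nat) (M : topologicalType)
    (S : manifold R n M) (g : riemannian S) (x : M) (v : 'rV[R]_n) : R :=
  Num.sqrt (inner g x v v).

(* Every C^1 curve on [0, 1], with one-sided derivatives at the endpoints, is
   the restriction of a C^1 curve on the whole line. *)
Definition C1_curve (R : realType) (n : nat) (M : topologicalType)
    (S : manifold R n M) (gamma : R -> M) : Prop :=
  continuous gamma /\
  forall c, atlas S c -> @Cr R R 'rV[R]_n 1 (gamma @^-1` cdom c) (cfun c \o gamma).

Definition velocity (R : realType) (n : nat) (M : topologicalType)
    (S : manifold R n M) (gamma : R -> M) (t : R) : 'rV[R]_n :=
  derive1 (cfun (chart_at S (gamma t)) \o gamma) t.

Definition curve_length (R : realType) (n : nat) (M : topologicalType)
    (S : manifold R n M) (g : riemannian S) (gamma : R -> M) : \bar R :=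
  (\int[lebesgue_measure]_(t in `[0%R, 1%R])
     (tnorm g (gamma t) (velocity S gamma t))%:E)%E.

(* [piecewise_path g x y l]: some piecewise C^1 path from x to y has length l;
   each C^1 piece is parametrized by [0, 1]. *)
Inductive piecewise_path (R : realType) (n : nat) (M : topologicalType)
    (S : manifold R n M) (g : riemannian S) : M -> M -> \bar R -> Prop :=
| piecewise_nil x : piecewise_path g x x 0%E
| piecewise_cons gamma y l :
    C1_curve S gamma -> piecewise_path g (gamma 1) y l ->
    piecewise_path g (gamma 0) y (curve_length g gamma + l)%E.

(* Equal to +oo between distinct connected components. *)
Definition riem_dist (R : realType) (n : nat) (M : topologicalType)
    (S : manifold R n M) (g : riemannian S) (x y : M) : \bar R :=
  ereal_inf [set l | piecewise_path g x y l].

(* E restricts to a continuous subbundle of TM over L: near each point of L it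
   has a continuous local frame [e], written in the coordinates of a chart. *)
Definition continuous_subbundle (R : realType) (n : nat) (M : topologicalType)
    (S : manifold R n M) (L : set M) (E : M -> {vspace 'rV[R]_n}) : Prop :=
  forall x, L x -> exists (U : set M) (k : nat) (e : 'I_k -> M -> 'rV[R]_n),
    [/\ open U, U x, U `<=` cdom (chart_at S x),
        (forall i, {within L `&` U, continuous (e i)}) &
        forall y, L y -> U y ->
          basis_of (E y)
            [seq from_chart S (chart_at S x) y (e i y) | i <- enum 'I_k]].

Definition hyperbolic (R : realType) (n : nat) (M : topologicalType)
    (S : manifold R n M) (g : riemannian S) (r : nat) (f : diffeo S r)
    (L : set M) : Prop :=
  [/\ compact L, f @` L = L &
  exists Es Eu : M -> {vspace 'rV[R]_n},
    [/\ continuous_subbundle S L Es,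
        continuous_subbundle S L Eu,
        (forall x, L x ->
           (Es x + Eu x)%VS = fullv /\ (Es x :&: Eu x)%VS = 0%VS),
        (forall x, L x ->
           (linfun (tangent_map S f x) @: Es x)%VS = Es (f x) /\
           (linfun (tangent_map S f x) @: Eu x)%VS = Eu (f x)) &
        exists c lambda : R, [/\ 0 < c, 0 < lambda < 1 &
          forall x, L x -> forall m : nat,
            (forall v, v \in Es x ->
               tnorm g (iterz f m%:Z x) (tangent_map S (iterz f m%:Z) x v)
                 <= c * lambda ^+ m * tnorm g x v) /\
            (forall v, v \in Eu x ->
               tnorm g (iterz f (- m%:Z) x)
                   (tangent_map S (iterz f (- m%:Z)) x v)
                 <= c * lambda ^+ m * tnorm g x v)]]].

Definition nonwandering (M : topologicalType) (f : M -> M) : set M :=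
  [set x | forall U, open U -> U x ->
     exists2 m : nat, (0 < m)%N & (iter m f @` U) `&` U !=set0].

Definition periodic_point (M : Type) (f : M -> M) : set M :=
  [set x | exists2 m : nat, (0 < m)%N & iter m f x = x].

Definition axiomA (R : realType) (n : nat) (M : topologicalType)
    (S : manifold R n M) (g : riemannian S) (r : nat) (f : diffeo S r) : Prop :=
  hyperbolic g f (nonwandering f) /\
  nonwandering f `<=` closure (periodic_point f).

(* Transitivity and mixing of the restriction of f to an invariant set L: the
   relatively open subsets of L are the U `&` L with U open. *)
Definition transitive_on (M : topologicalType) (f : M -> M) (L : set M) : Prop :=
  forall U V, open U -> open V -> U `&` L !=set0 -> V `&` L !=set0 ->
    exists m : nat, (iter m f @` (U `&` L)) `&` (V `&` L) !=set0.

Definition mixing_on (M : topologicalType) (f : M -> M) (L : set M) : Prop :=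
  forall U V, open U -> open V -> U `&` L !=set0 -> V `&` L !=set0 ->
    exists N : nat, forall m : nat, (N <= m)%N ->
      (iter m f @` (U `&` L)) `&` (V `&` L) !=set0.

Definition spectral_decomposition (M : topologicalType) (f : M -> M)
    (P : set (set M)) : Prop :=
  [/\ finite_set P, trivIset P id, \bigcup_(A in P) A = nonwandering f &
      forall A, P A -> [/\ A !=set0, closed A, f @` A = A & transitive_on f A]].

(* For an Axiom A diffeomorphism the decomposition P exists and is unique. *)
Definition basic_set (M : topologicalType) (f : M -> M) (B : set M) : Prop :=
  exists2 P, spectral_decomposition f P & P B.

(* Main.v *)
Require Import Defs.
From HB Require Import structures.
From mathcomp Require Import all_boot all_order all_algebra.
From mathcomp Require Import all_classical all_reals all_analysis.
From mathcomp Require Import measurable_realfun ring lra zify.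
Set Implicit Arguments.
Unset Strict Implicit.
Unset Printing Implicit Defensive.
Import Order.TTheory GRing.Theory Num.Theory.
Import numFieldNormedType.Exports.
Local Open Scope classical_set_scope.
Local Open Scope ring_scope.


(** Specification is obtained from periodic shadowing. Mixing fills the gap
between two consecutive orbit segments, and the gap between the last and the
first one, with a piece of orbit of B of the prescribed length, up to small jumps
(mixing_uniform); this makes the segments part of one periodic pseudo-orbit in
B (pseudo_orbit_through). A nearby periodic orbit of f shadows it
(hyperbolic_periodic_shadowing). Its points are nonwandering and close to B, and
the other basic sets are at a positive distance from B, so they lie in B
(periodic_near_basic).

Shadowing a periodic pseudo-orbit of length p is a fixed point problem in the
finite-dimensional space of p-tuples of corrections in charts. The constants
relating chart norms, Riemannian norms and projections on the stable and unstable
bundles are bounded by some K over finitely many charts (splitting_atlas). Since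
K depends on the splitting only, f may be replaced by an iterate F whose rate
beats all of them. Then the map which transports the stable parts of the
corrections forwards by F, and the unstable parts backwards by the inverse of F, is
a contraction with constant 1/2 (hyperbolic_chain_orbit). An orbit of F followed
for boundedly many steps of f stays close to the pseudo-orbit
(pseudo_orbit_drift), so the orbit found for F shadows for f.

Closeness in M is expressed by neighbourhoods of the diagonal. The Riemannian
distance enters at one place only: it is smaller than any given positive number on
such a neighbourhood (riem_dist_diag_nbhs). *)

(** * Neighbourhoods of the diagonal *)

Section diagonal.
Variable M : topologicalType.

Definition diag_nbhs (V : set (M * M)) := forall x : M, nbhs (x, x) V.

Lemma diag_nbhsT : diag_nbhs setT.
Proof. by move=> x; exact: filterT. Qed.

Lemma diag_nbhsI V W : diag_nbhs V -> diag_nbhs W -> diag_nbhs (V `&` W).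
Proof. by move=> dV dW x; exact: filterI. Qed.

Lemma diag_nbhs_refl V x : diag_nbhs V -> V (x, x).
Proof. by move=> dV; exact: (nbhs_singleton (dV x)). Qed.

Lemma diag_nbhs_bigcap (I : eqType) (D : seq I) (V : I -> set (M * M)) :
  (forall i, diag_nbhs (V i)) ->
  exists2 W, diag_nbhs W & forall i, i \in D -> W `<=` V i.
Proof.
move=> dV; elim: D => [|i D [W dW WV]]; first by exists setT => //; exact: diag_nbhsT.
exists (V i `&` W); first exact: diag_nbhsI.
by move=> j; rewrite inE => /predU1P[->|/WV jW] p [] // _ /jW.
Qed.

Lemma diag_nbhs_preimage (f : M -> M) V : continuous f -> diag_nbhs V ->
  diag_nbhs [set p | V (f p.1, f p.2)].
Proof.
move=> cf dV x; have [[A B] /= [Ax Bx] AB] := dV (f x).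
exists (f @^-1` A, f @^-1` B) => /=; first by split; exact: cf.
by move=> -[a b] /= [? ?]; exact: AB.
Qed.

Hypotheses (Mcompact : compact [set: M]) (Mhausdorff : hausdorff_space M).

(** The Lebesgue number lemma, with a neighbourhood of the diagonal in the role
of the number. *)
Lemma lebesgue_cover (O : M -> set M) : (forall x, nbhs x (O x)) ->
  exists (D : seq M) (V : set (M * M)), diag_nbhs V /\
    forall b, exists2 x, x \in D & forall a, V (b, a) \/ V (a, b) -> O x a.
Proof.
move=> Onbhs.
have shrink x : exists U, nbhs x U /\ closure U `<=` interior (O x).
  have [U Ux UO] := compact_regular Mhausdorff Mcompact
    (filterT : nbhs x setT) (nbhs_interior (Onbhs x)).
  by exists U.
have [U /all_and2[Unbhs UO]] := choice shrink.
have [[x0 _]|M0] := pselect ([set: M] !=set0); last first.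
  exists [::], setT; split; first exact: diag_nbhsT.
  by move=> b; case: M0; exists b.
pose pM : ptopologicalType := HB.pack M (isPointed.Build M x0).
have Mcov : cover_compact [set: M].
  by move: (Mcompact : @compact pM setT); rewrite compact_cover.
have [|x _|D _ cov] := Mcov M setT (fun x => interior (U x)).
- by move=> x _; exact: open_interior.
- by exists x => //; apply: nbhs_singleton; exact: nbhs_interior.
pose V x : set (M * M) := [set p | (closure (U x) p.1 -> O x p.2) /\
  (closure (U x) p.2 -> O x p.1)].
have dV x : diag_nbhs (V x).
  move=> y; have [clUy|nclUy] := pselect (closure (U x) y).
    have Oy : nbhs y (O x) by apply: UO.
    exists (O x, O x); first by split.
    by move=> -[a b] /= [? ?]; split.
  have Cy : nbhs y (~` closure (U x)).
    by apply: open_nbhs_nbhs; split => //; rewrite openC; exact: closed_closure.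
  exists (~` closure (U x), ~` closure (U x)); first by split.
  by move=> -[a b] /= [? ?]; split.
have [W dW WV] := diag_nbhs_bigcap (finmap.enum_fset D) dV.
exists (finmap.enum_fset D), W; split => // b.
have [x /= Dx Ub] := cov b I; exists x => // a Wab.
have clUb : closure (U x) b by apply: subset_closure; exact: interior_subset Ub.
have inD : x \in finmap.enum_fset D by [].
by case: Wab => /(WV _ inD) [] h1 h2 /=; [exact: h1|exact: h2].
Qed.

(** Uniformity of the local estimates: [E r y y'] is a property of a scale [r], known
for y near x and y' near [F x] with a scale that depends on x. The cover of M is
indexed by the images of the points x, and by the complement of [L]. *)
Lemma uniform_on_graph (R : realType) (L : set M) (F G : M -> M)
    (E : R -> M -> M -> Prop) :
  closed L -> cancel F G -> cancel G F -> continuous G ->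
  (forall r s y y', 0 < s <= r -> E r y y' -> E s y y') ->
  (forall x, L x -> exists2 r, 0 < r &
     \forall y \near x & y' \near F x, L y -> L y' -> E r y y') ->
  exists2 r, 0 < r & exists2 V, diag_nbhs V &
    forall y y', L y -> L y' -> V (F y, y') -> E r y y'.
Proof.
move=> clL FK GK cG Emono Eloc.
have loc (q : M) : exists rO : R * set M, [/\ 0 < rO.1, nbhs q rO.2 &
    (L (G q) -> forall y y', L y -> L y' -> rO.2 (F y) -> rO.2 y' -> E rO.1 y y')
    /\ (~ L (G q) -> forall y, L y -> ~ rO.2 (F y))].
  have [Lq|nLq] := pselect (L (G q)).
    have [r r0 [[A B] /= [Ax Bx] AB]] := Eloc _ Lq.
    exists (r, G @^-1` A `&` B); split => //.
      by apply: filterI; [exact: cG|rewrite -[q]GK].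
    split => // _ y y' Ly Ly' [+ _] [_ By'] => /=; rewrite FK => Ay.
    exact: (AB (y, y')).
  exists (1, G @^-1` (~` L)); split => //=.
    by apply: cG; apply: open_nbhs_nbhs; split => //; rewrite openC.
  by split => // _ y Ly; rewrite FK.
have [rO rOP] := choice loc.
have Onbhs x : nbhs x (rO x).2 by have [] := rOP x.
have [D [V [dV DV]]] := lebesgue_cover Onbhs.
have [r r0 rD] : exists2 r, 0 < r & forall q, q \in D -> r <= (rO q).1.
  elim: D {DV} => [|q D [r r0 rD]]; first by exists 1.
  exists (Num.min (rO q).1 r); first by rewrite lt_min r0 andbT; case: (rOP q).
  by move=> p; rewrite inE ge_min => /predU1P[->|/rD ->]; rewrite ?lexx ?orbT.
exists r => //; exists V => // y y' Ly Ly' VF.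
have [q qD Oq] := DV (F y).
have OF : (rO q).2 (F y) by apply: Oq; left; exact: diag_nbhs_refl.
have Oy' : (rO q).2 y' by apply: Oq; left.
have [q0 _ [inL outL]] := rOP q.
apply: (Emono (rO q).1); first by rewrite r0 rD.
have [LG|/outL/(_ _ Ly)//] := pselect (L (G q)).
exact: inL.
Qed.

(** The halving of an entourage. *)
Lemma diag_nbhs_comp V : diag_nbhs V ->
  exists2 W, diag_nbhs W & forall a b c, W (a, b) -> W (b, c) -> V (a, c).
Proof.
move=> dV.
have loc (x : M) : exists O : set M, nbhs x O /\ forall a c, O a -> O c -> V (a, c).
  have [[A B] /= [Ax Bx] AB] := dV x; exists (A `&` B); split; first exact: filterI.
  by move=> a c [Aa _] [_ Bc]; exact: AB.
have [N /all_and2[Nnbhs NV]] := choice loc.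
have [D [W [dW DW]]] := lebesgue_cover Nnbhs.
exists W => // a b c Wab Wbc; have [x _ Nx] := DW b.
by apply: (NV x); apply: Nx; [right|left].
Qed.

End diagonal.

Section mixing.
Variables (M : topologicalType) (f : M -> M) (B : set M).
Hypotheses (Mcompact : compact [set: M]) (Mhausdorff : hausdorff_space M).
Hypothesis fmix : mixing_on f B.

(** Finitely many pairs of small open sets suffice, so one waiting time serves all
pairs of points. *)
Lemma mixing_uniform (V : set (M * M)) : diag_nbhs V ->
  exists N : nat, forall x y m, B x -> B y -> (N <= m)%N ->
    exists2 q, B q & V (x, q) /\ V (iter m f q, y).
Proof.
move=> dV.
have loc (x : M) : exists O : set M, nbhs x O /\ forall a c, O a -> O c -> V (a, c).
  have [[A C] /= [Ax Cx] AC] := dV x; exists (A `&` C); split; first exact: filterI.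
  by move=> a c [Aa _] [_ Cc]; exact: AC.
have [N /all_and2[Nnbhs NV]] := choice loc.
have [D [W [dW DW]]] := lebesgue_cover Mcompact Mhausdorff Nnbhs.
have pair p : exists K : nat, (interior (N p.1) `&` B !=set0 ->
    interior (N p.2) `&` B !=set0 -> forall m, (K <= m)%N ->
    exists q, [/\ B q, N p.1 q & N p.2 (iter m f q)]).
  have [ne1|] := pselect (interior (N p.1) `&` B !=set0); last by exists 0%N.
  have [ne2|] := pselect (interior (N p.2) `&` B !=set0); last by exists 0%N.
  have [K KP] := fmix (@open_interior _ _) (@open_interior _ _) ne1 ne2.
  exists K => _ _ m /KP[_ [[q [q1 Bq] <-] [q2 _]]].
  by exists q; split => //; exact: interior_subset.
have [K KP] := choice pair.
exists (\max_(p <- [seq (a, b) | a <- D, b <- D]) K p)%N => x y m Bx By Km.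
have int z : exists2 w, w \in D & N w z /\ interior (N w) z.
  have [w wD Nw] := DW z; exists w => //; split.
    by apply: Nw; left; exact: diag_nbhs_refl.
  have [[A C] /= [Az Cz] AC] := dW z; apply: filterS Cz => c Cc.
  by apply: Nw; left; apply: AC; split => //=; exact: nbhs_singleton.
have [p pD [Opx ipx]] := int x; have [p' pD' [Opy ipy]] := int y.
have Kpp : (K (p, p') <= m)%N.
  apply: leq_trans Km; apply: (@leq_bigmax_seq _ _ xpredT K) => //.
  by apply/allpairsP; exists (p, p').
have [q [Bq Oq Oq']] := KP (p, p') (ex_intro _ x (conj ipx Bx))
  (ex_intro _ y (conj ipy By)) m Kpp.
by exists q => //; split; [exact: (NV p)|exact: (NV p')].
Qed.

End mixing.


(** * Chains of hyperbolic maps *)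

Section matrix_norm.
Variable R : realType.

Lemma mx_norm_le m n (A : 'M[R]_(m, n)) c :
  0 <= c -> (forall i j, `|A i j| <= c) -> `|A| <= c.
Proof.
move=> c0 Ac; rewrite [leLHS]/Num.norm /= mx_normrE; apply/bigmax_leP; split => //.
Qed.

Lemma mx_coord_le m n (A : 'M[R]_(m, n)) i j : `|A i j| <= `|A|.
Proof.
rewrite [leRHS]/Num.norm /= mx_normrE.
by apply: (@le_bigmax _ _ _ 0 (fun ij => `|A ij.1 ij.2|) (i, j)).
Qed.

Lemma mx_row_le m n (A : 'M[R]_(m, n)) i : `|row i A| <= `|A|.
Proof. by apply: mx_norm_le => // k j; rewrite mxE mx_coord_le. Qed.

Lemma mx_norm_rows m n (A : 'M[R]_(m, n)) c :
  0 <= c -> (forall i, `|row i A| <= c) -> `|A| <= c.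
Proof.
move=> c0 Ac; apply: mx_norm_le => // i j.
by rewrite (le_trans _ (Ac i))// (le_trans _ (mx_coord_le _ 0 j))// mxE.
Qed.

Lemma sub_mxE m n (A B : 'M[R]_(m, n)) i j : (A - B) i j = A i j - B i j.
Proof. by rewrite mxE [X in _ + X]mxE. Qed.

Lemma mulmx_norm m n p (A : 'M[R]_(m, n)) (B : 'M[R]_(n, p)) :
  `|A *m B| <= n%:R * `|A| * `|B|.
Proof.
apply: mx_norm_le => [|i j]; first by rewrite !mulr_ge0.
rewrite mxE (le_trans (ler_norm_sum _ _ _))//.
apply: (@le_trans _ _ (\sum_(k < n) `|A| * `|B|)).
  by apply: ler_sum => k _; rewrite normrM ler_pM// mx_coord_le.
by rewrite sumr_const card_ord -mulrA mulr_natl.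
Qed.

End matrix_norm.

(** Completeness, for the contraction principle. *)
HB.instance Definition _ (R : realType) m n :=
  Uniform_isComplete.Build 'M[R]_(m, n) cauchy_cvg.

Section hyperbolic_chain.
Variables (R : realType) (n p : nat) (P : 'I_p -> 'M[R]_n).
Variables (G H : 'I_p -> 'rV[R]_n -> 'rV[R]_n) (r rho : R).
(* The estimates hold at scale [r]; the orbit is sought at the smaller scale
   [rho], so that one backward step does not leave the former. [P i] projects on
   the stable direction, along the unstable one. *)
Hypotheses (rho0 : 0 < rho) (rhor : rho <= r).
Hypothesis P_idem : forall i, P i *m P i = P i.
Hypothesis G_contr : forall i x y, `|x| <= r -> `|y| <= r ->
  `|(G i x - G i y) *m P (ordS i)| <= 4^-1 * `|x - y|.
Hypothesis H_contr : forall i x y, `|x| <= r -> `|y| <= r ->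
  `|(H i x - H i y) *m (1%:M - P i)| <= 4^-1 * `|x - y|.
Hypothesis G_transverse : forall i x y, `|x| <= r -> `|y| <= r ->
  (x - y) *m (1%:M - P i) = 0 -> (G i x - G i y) *m P (ordS i) = 0 -> x = y.
Hypothesis GHK : forall i w, `|w| <= rho -> `|H i w| <= r /\ G i (H i w) = w.
Hypothesis G0_small : forall i, `|G i 0 *m P (ordS i)| <= rho / 4.
Hypothesis H0_small : forall i, `|H i 0 *m (1%:M - P i)| <= rho / 4.

Let T (w : 'M[R]_(p, n)) : 'M[R]_(p, n) := \matrix_i
  (G (ord_pred i) (row (ord_pred i) w) *m P i + H i (row (ordS i) w) *m (1%:M - P i)).

Let row_rho (w : 'M[R]_(p, n)) i : `|w| <= rho -> `|row i w| <= rho.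
Proof. by move=> wr; rewrite (le_trans (mx_row_le _ _)). Qed.

Let row_r (w : 'M[R]_(p, n)) i : `|w| <= rho -> `|row i w| <= r.
Proof. by move=> wr; rewrite (le_trans (row_rho _ wr)). Qed.

Let Pproj i : P i *m (1%:M - P i) = 0.
Proof. by rewrite mulmxBr mulmx1 P_idem subrr. Qed.

Let Qproj i : (1%:M - P i) *m P i = 0.
Proof. by rewrite mulmxBl mul1mx P_idem subrr. Qed.

Let Q_idem i : (1%:M - P i) *m (1%:M - P i) = 1%:M - P i.
Proof. by rewrite mulmxBr mulmx1 Qproj subr0. Qed.

Let T_lip w w' : `|w| <= rho -> `|w'| <= rho -> `|T w - T w'| <= 2^-1 * `|w - w'|.
Proof.
move=> wr wr'; apply: mx_norm_rows => [|i]; first by rewrite mulr_ge0.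
rewrite linearB /= !rowK opprD addrACA -!mulmxBl.
apply: le_trans (ler_normD _ _) _.
have := G_contr (ord_pred i) (row_r (ord_pred i) wr) (row_r (ord_pred i) wr').
have := H_contr i (row_r (ordS i) wr) (row_r (ordS i) wr').
rewrite ord_predK -!linearB /=.
have := mx_row_le (w - w') (ordS i); have := mx_row_le (w - w') (ord_pred i).
lra.
Qed.

Let T_stable w : `|w| <= rho -> `|T w| <= rho.
Proof.
move=> wr; apply: mx_norm_rows => [|i]; first exact: ltW.
have r0 : `|0 : 'rV[R]_n| <= r by rewrite normr0 (le_trans (ltW rho0)).
rewrite rowK.
have := G_contr (ord_pred i) (row_r (ord_pred i) wr) r0.
have := H_contr i (row_r (ordS i) wr) r0.
have := G0_small (ord_pred i); have := H0_small i.
have := row_rho (ord_pred i) wr; have := row_rho (ordS i) wr.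
rewrite ord_predK !subr0 !mulmxBl.
move: (H i (row (ordS i) w) *m _) (H i 0 *m _) (G (ord_pred i) (row _ w) *m _)
  (G (ord_pred i) 0 *m _) => a b c d.
have := ler_normD c a; have := ler_normD (c - d) d; have := ler_normD (a - b) b.
rewrite !subrK; lra.
Qed.

(** The stable parts are transported forwards and the unstable parts backwards,
which makes a single contraction of the space of chains. Its fixed point is an
orbit by transversality: [w i] and [H i (w (ordS i))] differ by a stable vector,
and their images under [G i] by an unstable one. *)
Lemma hyperbolic_chain_orbit :
  exists w : 'I_p -> 'rV[R]_n, forall i, `|w i| <= rho /\ G i (w i) = w (ordS i).
Proof.
pose U := [set w : 'M[R]_(p, n) | `|w| <= rho].
have TU : {homo T : w / U w} by exact: T_stable.
pose TF : {fun U >-> U} := mkfun_fun TU.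
have [w Uw wT] : exists2 w, U w & w = T w.
  apply: (@banach_fixed_point R _ U TF).
  - exists (2^-1)%:nng; split => /=; first by rewrite invf_lt1 ?ltr1n.
    by move=> [x y] /= [Ux Uy]; exact: T_lip.
  - apply: (@closed_comp _ _ (fun w : 'M[R]_(p, n) => `|w|) [set t | t <= rho]).
      by move=> x _; exact: norm_continuous.
    exact: closed_le.
  - by exists 0; rewrite /U /= normr0 ltW.
exists (fun i => row i w) => i; split; first exact: row_rho.
have wi : row i w = G (ord_pred i) (row (ord_pred i) w) *m P i +
  H i (row (ordS i) w) *m (1%:M - P i) by rewrite {1}wT rowK.
have wSi : row (ordS i) w = G i (row i w) *m P (ordS i) +
  H (ordS i) (row (ordS (ordS i)) w) *m (1%:M - P (ordS i)).
  by rewrite {1}wT rowK ordSK.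
have [Hr GHi] := GHK i (row_rho (ordS i) Uw).
suff <- : H i (row (ordS i) w) = row i w by rewrite GHi.
apply: (@G_transverse i) => //; first exact: row_r.
  rewrite mulmxBl wi mulmxDl -!mulmxA Pproj mulmx0 add0r.
  by rewrite Q_idem subrr.
by rewrite GHi mulmxBl {1}wSi mulmxDl -!mulmxA Qproj mulmx0 addr0 P_idem subrr.
Qed.

End hyperbolic_chain.


(** * Strict differentiability *)

Section strict_derivative.
Variable R : realType.

(** Strict differentiability at a point is the exact amount of C^1 regularity that
the local estimates use, and unlike continuity of the differential it passes to
composites at once. *)
Definition strict_diff n m (h : 'rV[R]_n -> 'rV[R]_m) (z : 'rV[R]_n) (A : 'M[R]_(n, m)) :=
  forall k : R, 0 < k -> exists2 d : R, 0 < d &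
    forall a b, `|a - z| < d -> `|b - z| < d -> `|h a - h b - (a - b) *m A| <= k * `|a - b|.

Lemma strict_diff_lipschitz n m (h : 'rV[R]_n -> 'rV[R]_m) (z : 'rV[R]_n) A :
  strict_diff h z A -> exists2 d, 0 < d & exists2 L, 0 < L &
    forall a b, `|a - z| < d -> `|b - z| < d -> `|h a - h b| <= L * `|a - b|.
Proof.
move=> /(_ _ ltr01)[d d0 hd]; exists d => //.
exists (1 + n%:R * `|A|) => [|a b az bz]; first by rewrite ltr_pwDl// mulr_ge0.
have := hd a b az bz; have := mulmx_norm (a - b) A.
have := ler_normD (h a - h b - (a - b) *m A) ((a - b) *m A); rewrite subrK.
rewrite mulrDl [_ * _ * `|A|]mulrAC; lra.
Qed.

Lemma strict_diff_continuous n m (h : 'rV[R]_n -> 'rV[R]_m) (z : 'rV[R]_n) A :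
  strict_diff h z A -> {for z, continuous h}.
Proof.
move=> /strict_diff_lipschitz[d d0 [L L0 hL]] P /nbhs_ballP[e e0 eP].
apply/nbhs_ballP; exists (Num.min d (L^-1 * e)) => [|a].
  by rewrite /= lt_min d0 mulr_gt0// invr_gt0.
rewrite -ball_normE /= lt_min => /andP[az aL]; apply: eP; rewrite -ball_normE /=.
apply: le_lt_trans (hL _ _ _ _) _; rewrite ?subrr ?normr0 1?distrC//.
by rewrite -ltr_pdivlMl// distrC.
Qed.

Lemma strict_diff_near n m (h h' : 'rV[R]_n -> 'rV[R]_m) (z : 'rV[R]_n) A :
  (\forall a \near z, h a = h' a) -> strict_diff h z A -> strict_diff h' z A.
Proof.
move=> /nbhs_ballP[e e0 eP] hA k /hA[d d0 dP].
exists (Num.min d e) => [|a b]; first by rewrite lt_min d0.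
rewrite !lt_min => /andP[ad ae] /andP[bd be].
have <- : h a = h' a by apply: eP; rewrite -ball_normE /= distrC.
have <- : h b = h' b by apply: eP; rewrite -ball_normE /= distrC.
exact: dP.
Qed.

Lemma strict_diff_id n z : strict_diff (@id 'rV[R]_n) z 1%:M.
Proof.
by move=> k k0; exists 1 => // a b _ _; rewrite mulmx1 subrr normr0 mulr_ge0// ltW.
Qed.

Lemma strict_diff_mulmx n m (A : 'M[R]_(n, m)) z : strict_diff (mulmx^~ A) z A.
Proof.
by move=> k k0; exists 1 => // a b _ _; rewrite -mulmxBl subrr normr0 mulr_ge0// ltW.
Qed.

Lemma strict_diff_comp n m l (h : 'rV[R]_n -> 'rV[R]_m)
    (g : 'rV[R]_m -> 'rV[R]_l) (z : 'rV[R]_n) A B :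
  strict_diff h z A -> strict_diff g (h z) B -> strict_diff (g \o h) z (A *m B).
Proof.
move=> hA gB k k0; have [dh dh0 [L L0 hL]] := strict_diff_lipschitz hA.
have [|d1 d10 gd1] := gB (k / 2 / L); first by rewrite !divr_gt0.
pose K := 1 + m%:R * `|B|; have K0 : 0 < K by rewrite ltr_pwDl// mulr_ge0.
have [|d2 d20 hd2] := hA (k / 2 / K); first by rewrite !divr_gt0.
have /cvgrPdist_lt/(_ _ d10)/nbhs_ballP[d3 d30 hd3] := strict_diff_continuous hA.
exists (Num.min dh (Num.min d2 d3)) => [|a b]; first by rewrite !lt_min dh0 d20.
rewrite !lt_min => /and3P[a1 a2 a3] /and3P[b1 b2 b3] /=.
have ha : `|h a - h z| < d1 by rewrite distrC; apply: hd3; rewrite -ball_normE /= distrC.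
have hb : `|h b - h z| < d1 by rewrite distrC; apply: hd3; rewrite -ball_normE /= distrC.
have := gd1 _ _ ha hb; have := hd2 _ _ a2 b2; have := hL _ _ a1 b1.
set u := h a - h b => u1 u2 u3.
rewrite mulmxA -(subrKA (u *m B)) -mulmxBl.
apply: le_trans (ler_normD _ _) _; have := mulmx_norm (u - (a - b) *m A) B.
have {u3}: `|g (h a) - g (h b) - u *m B| <= k / 2 * `|a - b|.
  apply: le_trans u3 _; rewrite -[_ / L * _]mulrA.
  apply: ler_wpM2l; first by rewrite divr_ge0 ?ltW.
  by rewrite ler_pdivrMl.
have : K * `|u - (a - b) *m A| <= k / 2 * `|a - b|.
  by rewrite mulrC -ler_pdivlMr// mulrAC.
rewrite /K mulrDl mul1r [_ * _ * `|B|]mulrAC.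
have := normr_ge0 (u - (a - b) *m A); lra.
Qed.

Lemma strict_diff_diff n m (h : 'rV[R]_n -> 'rV[R]_m) (z : 'rV[R]_n) A :
  strict_diff h z A -> differentiable h z /\ forall v, 'd h z v = v *m A.
Proof.
move=> hA; have cA : continuous (mulmxr A : 'rV[R]_n -> _).
  by move=> x; apply: strict_diff_continuous (strict_diff_mulmx A x).
have lo e : 0 < e -> \forall v \near (0 : 'rV[R]_n),
    `|(h \o shift z - (cst (h z) + (mulmxr A : 'rV[R]_n -> _))) v| <= e * `|v|.
  move=> e0; have [d d0 hd] := hA _ e0; apply/nbhs_ballP; exists d => // v.
  rewrite -ball_normE /= sub0r normrN => vd.
  have := hd (v + z) z; rewrite addrK subrr normr0 => /(_ vd d0).
  by rewrite !fctE opprD addrA.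
have dE : 'd h z = mulmxr A :> ('rV[R]_n -> 'rV[R]_m).
  by apply: diff_unique => //; apply/eqaddoP.
split; last by move=> v; rewrite dE.
by apply/diff_locallyP; rewrite dE; split => //; apply/eqaddoP.
Qed.

Lemma diff_jacobian n m (h : 'rV[R]_n -> 'rV[R]_m) (z v : 'rV[R]_n) :
  'd h z v = v *m jacobian h z.
Proof. by rewrite mul_rV_lin1. Qed.

Lemma strict_diff_jacobian n m (h : 'rV[R]_n -> 'rV[R]_m) (z : 'rV[R]_n) A :
  strict_diff h z A -> jacobian h z = A.
Proof.
move=> /strict_diff_diff[_ dh]; apply/row_matrixP => i.
by rewrite !rowE -dh diff_jacobian.
Qed.

Lemma Cr1_mulmx_jacobian n m (h : 'rV[R]_n -> 'rV[R]_m) (U : set 'rV[R]_n)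
    (z v : 'rV[R]_n) :
  Cr 1 U h -> U z ->
  {for z, continuous (fun y : 'rV[R]_n => (v *m jacobian h y : 'rV[R]_m))}.
Proof.
move=> [_ ch] Uz; have E : (fun y : 'rV[R]_n => 'd h y v) = (fun y => v *m jacobian h y).
  by apply/funext => y; exact: diff_jacobian.
rewrite -E; exact: (ch v z Uz).
Qed.

(** Continuity of the differential on each vector gives continuity in norm, in
finite dimension. *)
Lemma Cr1_jacobian n m (h : 'rV[R]_n -> 'rV[R]_m) (U : set 'rV[R]_n)
    (z : 'rV[R]_n) (e : R) :
  Cr 1 U h -> U z -> 0 < e ->
  \forall y \near z, `|jacobian h y - jacobian h z| <= e.
Proof.
move=> hC Uz e0.
pose f (i : 'I_n) : set 'rV[R]_n := [set x |
  `|(delta_mx 0 i : 'rV[R]_n) *m jacobian h x - delta_mx 0 i *m jacobian h z| < e].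
have : \forall x \near z, forall i, f i x.
  apply: (filter_forall (nbhs_filter z)) => i.
  have /cvgrPdistC_lt/(_ _ e0) := Cr1_mulmx_jacobian (v := delta_mx 0 i) hC Uz.
  exact.
apply: filterS => y yz; apply: mx_norm_rows => [|i]; first exact: ltW.
by rewrite rowE mulmxBr; apply: ltW; exact: yz.
Qed.

(** A C^1 map is strictly differentiable, by the mean value theorem in each
coordinate. *)
Lemma strict_diff_C1 n m (h : 'rV[R]_n -> 'rV[R]_m) (U : set 'rV[R]_n) (z : 'rV[R]_n) :
  open U -> Cr 1 U h -> U z -> strict_diff h z (jacobian h z).
Proof.
move=> Uo hC Uz k k0; have dh : forall x, U x -> differentiable h x by case: hC.
have n1 : 0 < n%:R + 1 :> R by rewrite ltr_wpDl.
have near_d := Cr1_jacobian hC Uz (divr_gt0 k0 n1).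
have : nbhs z (U `&` [set x : 'rV[R]_n | forall v : 'rV[R]_n,
    `|v *m jacobian h x - v *m jacobian h z| <= k * `|v|]).
  apply: filterI; first exact: open_nbhs_nbhs.
  apply: (@filterS _ _ (nbhs_filter z)) near_d => x Jx v.
  rewrite -mulmxBr; apply: le_trans (mulmx_norm _ _) _.
  have v0 := normr_ge0 v.
  apply: (@le_trans _ _ (n%:R * `|v| * (k / (n%:R + 1)))).
    by rewrite ler_wpM2l// mulr_ge0.
  rewrite mulrA ler_pdivrMr//; move: `|v| v0 => w w0.
  have : 0 <= k * w by rewrite mulr_ge0// ltW.
  lra.
move=> /nbhs_ballP[d d0 dP].
exists d => // a b az bz.
have seg (t : R) : 0 <= t <= 1 -> ball z d (b + t *: (a - b)).
  move=> /andP[t0 t1]; rewrite -ball_normE /= distrC.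
  have -> : b + t *: (a - b) - z = t *: (a - z) + (1 - t) *: (b - z).
    by apply/rowP => i; rewrite !mxE; ring.
  apply: le_lt_trans (ler_normD _ _) _; rewrite !normrZ (ger0_norm t0) ger0_norm ?subr_ge0//.
  have [tz|tp] := eqVneq t 0; first by rewrite tz mul0r add0r subr0 mul1r.
  have := ltr_pM2l (_ : 0 < t) `|a - z| d; rewrite lt_neqAle eq_sym tp t0 => /(_ isT).
  rewrite az; have : (1 - t) * `|b - z| <= (1 - t) * d by rewrite ler_wpM2l ?subr_ge0// ltW.
  lra.
apply: mx_norm_le => [|i j]; first by rewrite mulr_ge0// ltW.
pose c (t : R) := h (b + t *: (a - b)).
have dc (t : R) : 0 <= t <= 1 -> is_derive t (1 : R) c ((a - b) *m jacobian h (b + t *: (a - b))).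
  move=> t01; have [Uc _] := dP _ (seg t t01).
  have ci : is_diff t (fun t : R => b + t *: (a - b)) (fun t => t *: (a - b)).
    by apply: is_diff_eq; rewrite add0r.
  have cd : differentiable c t by apply: differentiable_comp => //; exact: dh.
  apply: DeriveDef; first exact: diff_derivable.
  rewrite deriveE// /c (_ : (fun _ => _) = h \o (fun t : R => b + t *: (a - b)))//.
  rewrite diff_comp//=; last exact: dh.
  by rewrite diff_val scale1r diff_jacobian.
pose phi (t : R) := c t i j - t * ((a - b) *m jacobian h z) i j.
have dphi (t : R) : 0 <= t <= 1 -> is_derive t (1 : R) phi
   (((a - b) *m jacobian h (b + t *: (a - b))) i j - ((a - b) *m jacobian h z) i j).
  move=> t01; have [cd cD] := dc t t01.
  have cij : is_derive t (1 : R) (fun t => c t i j)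
      (((a - b) *m jacobian h (b + t *: (a - b))) i j).
    apply: DeriveDef; first exact: (derivable_mxP _ _ _).1.
    by rewrite -cD derive_mx// mxE.
  pose K := ((a - b) *m jacobian h z) i j.
  have tK : is_derive t (1 : R) (fun u : R => K *: u) K.
    have h1 := is_deriveZ K (is_derive_id t (1 : R)).
    by apply: is_derive_eq h1 _; exact: mulr1.
  have -> : phi = (fun t => c t i j) - (fun u : R => K *: u).
    by apply/funext => u; rewrite /phi !fctE /= /K mulrC.
  have := @is_deriveB _ _ _ _ _ _ _ _ _ cij tK; exact.
have phic : {within `[0, 1], continuous phi}.
  apply: derivable_within_continuous => t /[!in_itv]/= t01.
  by have [] := dphi t t01.
have dphi' (t : R) : t \in `]0, 1[%R -> is_derive t (1 : R) phi
    (((a - b) *m jacobian h (b + t *: (a - b))) i j - ((a - b) *m jacobian h z) i j).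
  by rewrite in_itv /= => /andP[/ltW t0 /ltW t1]; apply: dphi; rewrite t0.
have [t t01] := MVT ltr01 dphi' phic.
rewrite subr0 mulr1 /phi /c scale1r scale0r addr0 mul0r subr0 mul1r subrKC => dE.
have [_ /(_ (a - b))] : (U `&` [set x | forall v : 'rV[R]_n,
    `|v *m jacobian h x - v *m jacobian h z| <= k * `|v|]) (b + t *: (a - b)).
  apply: dP; apply: seg; move: t01; rewrite in_itv /= => /andP[/ltW -> /ltW ->] //.
apply: le_trans; apply: le_trans (mx_coord_le _ i j).
rewrite !sub_mxE -dE le_eqVlt; apply/orP; left; apply/eqP; congr `|_|; ring.
Qed.

End strict_derivative.


(** * Maps read in charts *)

HB.lock Definition chart_jacobian (R : realType) (n : nat) (M : topologicalType)
    (c c' : chart R n M) (F : M -> M) (x : M) : 'M[R]_n :=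
  jacobian (cfun c' \o F \o cinv c) (cfun c x).

Section charts.
Variables (R : realType) (n : nat) (M : topologicalType) (S : manifold R n M).

Lemma Cr_continuous (V W : normedModType R) r (U : set V) (h : V -> W) :
  Cr r U h -> forall x, U x -> {for x, continuous h}.
Proof.
by case: r => [//|r] [dh _] x Ux; apply: differentiable_continuous; exact: dh.
Qed.

Lemma Cr_ge1 (V W : normedModType R) r (U : set V) (h : V -> W) :
  (1 <= r)%N -> Cr r U h -> Cr 1 U h.
Proof.
case: r => // r _ [dh ch]; split=> // v; exact: (Cr_continuous (ch v)).
Qed.

Lemma chart_jacobianE (c c' : chart R n M) (F : M -> M) (x : M) :
  chart_jacobian c c' F x = jacobian (cfun c' \o F \o cinv c) (cfun c x).
Proof. by rewrite chart_jacobian.unlock. Qed.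

(** All maps of the proof, namely the identity, f, its inverse and their iterates,
are treated through this class, which is closed under composition. *)
Definition strict_map (F : M -> M) := continuous F /\
  forall x c c', atlas S c -> atlas S c' -> cdom c x -> cdom c' (F x) ->
    strict_diff (cfun c' \o F \o cinv c) (cfun c x) (chart_jacobian c c' F x).

Lemma near_cdom (F : M -> M) x (c c' : chart R n M) : continuous F ->
  cdom c x -> cdom c' (F x) ->
  \forall z \near cfun c x, ccod c z /\ cdom c' (F (cinv c z)).
Proof.
move=> cF cx cFx; apply: filterI.
  by apply: open_nbhs_nbhs; split; [exact: ccod_open|exact: cfun_cod].
have : nbhs (cinv c (cfun c x)) (F @^-1` cdom c').
  rewrite cfunK//; apply: cF.
  by apply: open_nbhs_nbhs; split; [exact: cdom_open|].
exact: (cinv_continuous (cfun_cod cx)).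
Qed.

Lemma open_chart_dom (F : M -> M) (c c' : chart R n M) : continuous F ->
  open (ccod c `&` (F \o cinv c) @^-1` cdom c').
Proof.
move=> cF; rewrite openE => z [cz cFz].
have := near_cdom cF (cinv_dom cz) cFz; rewrite cinvK//.
Qed.

Lemma strict_map_Cr r F : (1 <= r)%N -> Cr_map S r F -> strict_map F.
Proof.
move=> r1 [cF CF]; split=> // x c c' ac ac' cx cFx.
rewrite chart_jacobianE; apply: (@strict_diff_C1 R n n _ _ _ (open_chart_dom cF)).
  exact: Cr_ge1 (CF _ _ ac ac').
by split; [exact: cfun_cod|rewrite /= cfunK].
Qed.

(** For the identity this is the smoothness of the changes of charts. *)
Lemma strict_map_id : strict_map id.
Proof.
split=> [x|x c c' ac ac' cx cx']; first exact: cvg_id.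
have cid : continuous (@id M) by move=> y; exact: cvg_id.
rewrite chart_jacobianE; apply: (@strict_diff_C1 R n n _ _ _ (open_chart_dom cid)).
  exact: (@transition_smooth _ _ _ S c c' ac ac' 1%N).
by split; [exact: cfun_cod|rewrite /= cfunK].
Qed.

Lemma strict_diff_chain (F G : M -> M) x (c c' c'' : chart R n M) :
  strict_map F -> strict_map G -> atlas S c -> atlas S c' -> atlas S c'' ->
  cdom c x -> cdom c' (F x) -> cdom c'' (G (F x)) ->
  strict_diff (cfun c'' \o (G \o F) \o cinv c) (cfun c x)
    (chart_jacobian c c' F x *m chart_jacobian c' c'' G (F x)).
Proof.
move=> [cF dF] [cG dG] ac ac' ac'' cx cFx cGFx.
apply: (strict_diff_near (h := (cfun c'' \o G \o cinv c') \o (cfun c' \o F \o cinv c))).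
  have := near_cdom cF cx cFx; apply: (@filterS _ _ (nbhs_filter _)) => z [_ zF] /=.
  by rewrite cfunK.
apply: strict_diff_comp; first exact: dF.
by rewrite /= cfunK//; exact: dG.
Qed.

Lemma strict_map_comp (F G : M -> M) :
  strict_map F -> strict_map G -> strict_map (G \o F).
Proof.
move=> sF sG; split=> [x|x c c'' ac ac'' cx cGFx].
  by apply: continuous_comp; [exact: sF.1|exact: sG.1].
have ac' := chart_at_atlas S (F x); have cFx := chart_at_dom S (F x).
have sGF := strict_diff_chain sF sG ac ac' ac'' cx cFx cGFx.
by rewrite [chart_jacobian _ _ _ _]chart_jacobianE (strict_diff_jacobian sGF).
Qed.

Lemma strict_map_iter (F : M -> M) k : strict_map F -> strict_map (iter k F).
Proof.
by move=> sF; elim: k => [|k IH]; [exact: strict_map_id|exact: strict_map_comp IH sF].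
Qed.

Lemma chart_jacobian_comp (F G : M -> M) x (c c' c'' : chart R n M) :
  strict_map F -> strict_map G -> atlas S c -> atlas S c' -> atlas S c'' ->
  cdom c x -> cdom c' (F x) -> cdom c'' (G (F x)) ->
  chart_jacobian c c'' (G \o F) x = chart_jacobian c c' F x *m chart_jacobian c' c'' G (F x).
Proof.
move=> sF sG ac ac' ac'' cx cFx cGFx.
rewrite [LHS]chart_jacobianE.
exact: strict_diff_jacobian (strict_diff_chain sF sG ac ac' ac'' cx cFx cGFx).
Qed.

Lemma chart_jacobian_id (c : chart R n M) x : cdom c x -> chart_jacobian c c id x = 1%:M.
Proof.
move=> cx; rewrite chart_jacobianE; apply: strict_diff_jacobian.
apply: (strict_diff_near (h := @id 'rV[R]_n)); last exact: strict_diff_id.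
apply: filterS (_ : nbhs _ (ccod c)) => [z cz|]; first by rewrite /= cinvK.
by apply: open_nbhs_nbhs; split; [exact: ccod_open|exact: cfun_cod].
Qed.

Lemma tangent_mapE F x v :
  tangent_map S F x v = v *m chart_jacobian (chart_at S x) (chart_at S (F x)) F x.
Proof. by rewrite chart_jacobianE; exact: diff_jacobian. Qed.

Lemma from_chartE (c : chart R n M) x v :
  from_chart S c x v = v *m chart_jacobian c (chart_at S x) id x.
Proof. by rewrite chart_jacobianE; exact: diff_jacobian. Qed.

Lemma from_chart_is_linear (c : chart R n M) x : linear (from_chart S c x).
Proof. by move=> a u v; rewrite !from_chartE mulmxDl scalemxAl. Qed.

Lemma tangent_map_from_chart F x (c c' : chart R n M) v : strict_map F ->
  atlas S c -> atlas S c' -> cdom c x -> cdom c' (F x) ->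
  tangent_map S F x (from_chart S c x v) = from_chart S c' (F x) (v *m chart_jacobian c c' F x).
Proof.
move=> sF ac ac' cx cFx; rewrite tangent_mapE !from_chartE -!mulmxA; congr (_ *m _).
have E1 := @chart_jacobian_comp id F x c (chart_at S x) (chart_at S (F x)) strict_map_id sF
  ac (chart_at_atlas _ _) (chart_at_atlas _ _) cx (chart_at_dom _ _) (chart_at_dom _ _).
have E2 := @chart_jacobian_comp F id x c c' (chart_at S (F x)) sF strict_map_id
  ac ac' (chart_at_atlas _ _) cx cFx (chart_at_dom _ _).
exact: (etrans (esym E1) E2).
Qed.

(** The two changes of charts at a point are inverse to each other. *)
Lemma from_chart_inj (c : chart R n M) x v : atlas S c -> cdom c x ->
  from_chart S c x v = 0 -> v = 0.
Proof.
move=> ac cx; rewrite from_chartE => v0.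
have := @chart_jacobian_comp id id x c (chart_at S x) c strict_map_id strict_map_id ac
  (chart_at_atlas S x) ac cx (chart_at_dom S x) cx.
rewrite (chart_jacobian_id cx) => E.
by rewrite -[v]mulmx1 E mulmxA v0 mul0mx.
Qed.

Lemma tangent_map_comp F G x v : strict_map F -> strict_map G ->
  tangent_map S (G \o F) x v = tangent_map S G (F x) (tangent_map S F x v).
Proof.
move=> sF sG; rewrite !tangent_mapE -mulmxA; congr (_ *m _).
by apply: chart_jacobian_comp => //; (exact: chart_at_atlas || exact: chart_at_dom).
Qed.

End charts.


(** * Comparison of norms *)

HB.lock Definition gram (R : realType) (n : nat) (M : topologicalType)
    (S : manifold R n M) (g : riemannian S) (c : chart R n M) (y : M) : 'M[R]_n :=
  \matrix_(i, j) inner g y (from_chart S c y (delta_mx 0 i))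
                           (from_chart S c y (delta_mx 0 j)).

Section riemannian_norm.
Variables (R : realType) (n : nat) (M : topologicalType) (S : manifold R n M).
Variable g : riemannian S.
Implicit Types (c : chart R n M) (x y : M) (u v w : 'rV[R]_n).

Lemma scalar_rV (f : 'rV[R]_n -> R) v : scalar f ->
  f v = \sum_i v 0 i * f (delta_mx 0 i).
Proof.
move=> flin; pose fL : {scalar 'rV[R]_n} := HB.pack f (GRing.isLinear.Build _ _ _ _ f flin).
rewrite -[LHS]/(fL v) {1}[v]row_sum_delta linear_sum; apply: eq_bigr => i _.
by rewrite linearZ.
Qed.

Lemma gramE c y i j : gram g c y i j =
  inner g y (from_chart S c y (delta_mx 0 i)) (from_chart S c y (delta_mx 0 j)).
Proof. by rewrite gram.unlock mxE. Qed.

Lemma inner_gram c y v w :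
  inner g y (from_chart S c y v) (from_chart S c y w) = (v *m gram g c y *m w^T) 0 0.
Proof.
have sc u : scalar (fun w => inner g y u (from_chart S c y w)).
  move=> a w1 w2; rewrite (from_chart_is_linear S c y a w1 w2).
  exact: inner_linear.
rewrite (scalar_rV _ (sc _)) mxE; apply: eq_bigr => j _.
rewrite mulrC [w^T _ _]mxE; congr (_ * _).
rewrite inner_sym (scalar_rV _ (sc _)) mxE; apply: eq_bigr => i _.
by rewrite gramE inner_sym.
Qed.

Lemma tnorm_from_chartZ c y (a : R) w :
  tnorm g y (from_chart S c y (a *: w)) = `|a| * tnorm g y (from_chart S c y w).
Proof.
rewrite /tnorm !inner_gram.
have -> : (a *: w) *m gram g c y *m (a *: w)^T = a ^+ 2 *: (w *m gram g c y *m w^T).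
  by rewrite linearZ /= -!scalemxAl -scalemxAr scalerA.
by rewrite [X in Num.sqrt X]mxE sqrtrM ?sqr_ge0// sqrtr_sqr.
Qed.

Lemma quad_bound (G : 'M[R]_n) v :
  `|(v *m G *m v^T) 0 0| <= n%:R ^+ 2 * `|G| * `|v| ^+ 2.
Proof.
apply: le_trans (mx_coord_le _ _ _) _; apply: le_trans (mulmx_norm _ _) _.
have vT : `|v^T| <= `|v| by apply: mx_norm_le => // i j; rewrite mxE mx_coord_le.
have n0 : 0 <= n%:R :> R by [].
apply: le_trans (ler_wpM2l _ vT) _; first by rewrite mulr_ge0.
apply: le_trans (ler_wpM2r _ (ler_wpM2l n0 (mulmx_norm v G))) _ => //.
by rewrite le_eqVlt; apply/orP; left; apply/eqP; ring.
Qed.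

Lemma gram_continuous c x (e : R) : atlas S c -> cdom c x -> 0 < e ->
  \forall y \near x, `|gram g c y - gram g c x| <= e.
Proof.
move=> ac cx e0.
pose P (ij : 'I_n * 'I_n) : set M :=
  [set y | `|gram g c y ij.1 ij.2 - gram g c x ij.1 ij.2| < e].
have : \forall y \near x, forall ij, P ij y.
  apply: (filter_forall (nbhs_filter x)) => -[i j].
  pose h z := inner g (cinv c z) (from_chart S c (cinv c z) (delta_mx 0 i))
                       (from_chart S c (cinv c z) (delta_mx 0 j)).
  have ch : {for x, continuous (h \o cfun c)}.
    apply: continuous_comp; first exact: cfun_continuous.
    exact: (@inner_smooth _ _ _ _ g c ac _ _ 0%N _ (cfun_cod cx)).
  have /cvgrPdistC_lt/(_ _ e0) := ch.
  have cdx : nbhs x (cdom c) by apply: open_nbhs_nbhs; split; [exact: cdom_open|].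
  have hE y : cdom c y -> (h \o cfun c) y = gram g c y i j.
    by move=> cy; rewrite gramE /h /= cfunK.
  move=> H; apply: filterS (filterI cdx H) => y [cy].
  by rewrite !hE.
apply: filterS => y Py; apply: mx_norm_le => [|i j]; first exact: ltW.
rewrite sub_mxE; exact/ltW/(Py (i, j)).
Qed.

Lemma quad_continuous (G : 'M[R]_n) :
  continuous (fun v : 'rV[R]_n => (v *m G *m v^T) 0 0).
Proof.
rewrite (_ : (fun _ => _) =
    (fun v : 'rV[R]_n => \sum_i (v *m G) 0 i * v 0 i)); last first.
  by apply/funext => w; rewrite mxE; apply: eq_bigr => i _; rewrite [w^T _ _]mxE.
apply: continuous_big => [|i _]; first exact: add_continuous.
move=> v.
have c1 : {for v, continuous (fun v : 'rV[R]_n => (v *m G) 0 i)}.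
  apply: (@continuous_comp _ _ _ (fun v : 'rV[R]_n => v *m G)
    (fun w : 'rV[R]_n => w 0 i)); last exact: coord_continuous.
  exact: strict_diff_continuous (strict_diff_mulmx G v).
exact: (@continuousM _ _ _ _ v c1 (@coord_continuous _ _ _ 0 i v)).
Qed.

(** A positive definite form is bounded below on the unit sphere, by compactness. *)
Lemma gram_pos c x : atlas S c -> cdom c x ->
  exists2 m : R, 0 < m & forall v, m * `|v| ^+ 2 <= (v *m gram g c x *m v^T) 0 0.
Proof.
move=> ac cx; pose A := [set v : 'rV[R]_n | `|v| = 1].
have qpos v : v != 0 -> 0 < (v *m gram g c x *m v^T) 0 0.
  move=> v0; rewrite -inner_gram; apply: inner_pos.
  by apply: contra_neq v0; exact: from_chart_inj.
have [[v0 Av0]|A0] := pselect (A !=set0); last first.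
  exists 1 => // v; have [->|v0] := eqVneq v 0.
    by rewrite normr0 expr0n mulr0 !mul0mx mxE.
  case: A0; exists (`|v|^-1 *: v); rewrite /A /= normrZ normfV normr_id.
  by rewrite mulVf// normr_eq0.
have cA : compact A.
  apply: bounded_closed_compact.
    by exists 1; split => // t t1 v /= ->; exact: ltW.
  apply: (@closed_comp _ _ (fun w : 'rV[R]_n => `|w|) [set t | t = 1]).
    by move=> x0 _; exact: norm_continuous.
  exact: closed_eq.
have [|v1 /set_mem Av1 v1min] := @EVT_min_rV R n
  (fun v => (v *m gram g c x *m v^T) 0 0) A (ex_intro _ v0 Av0) cA.
  by apply: continuous_subspaceT; exact: quad_continuous.
exists ((v1 *m gram g c x *m v1^T) 0 0) => [|v].
  apply: qpos; apply/eqP => v10; move: Av1.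
  by rewrite /A /= v10 normr0 => /eqP; rewrite eq_sym oner_eq0.
have [->|vn0] := eqVneq v 0; first by rewrite normr0 expr0n mulr0 !mul0mx mxE.
have nv : `|v| != 0 by rewrite normr_eq0.
have := v1min (`|v|^-1 *: v); rewrite inE /A /= normrZ normfV normr_id mulVf// => /(_ erefl).
rewrite linearZ /= -!scalemxAl -scalemxAr scalerA !mxE.
set q := (X in _ * X); rewrite -expr2 exprVn mulrC.
by rewrite -ler_pdivlMr ?invr_gt0 ?exprn_gt0 ?normr_gt0.
Qed.

(** The bounds for the Gram matrix at [x] persist near [x] by continuity. *)
Lemma tnorm_comparable c x : atlas S c -> cdom c x -> exists2 K : R, 0 < K &
  \forall y \near x, forall v, `|v| <= K * tnorm g y (from_chart S c y v) /\
    tnorm g y (from_chart S c y v) <= K * `|v|.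
Proof.
move=> ac cx; have [m m0 mP] := gram_pos ac cx.
pose n2 : R := n%:R ^+ 2; have n20 : 0 <= n2 by rewrite exprn_ge0.
have e0 : 0 < m / 2 / (n2 + 1) by rewrite !divr_gt0// ltr_wpDl.
pose C := n2 * (`|gram g c x| + m / 2 / (n2 + 1)).
have C0 : 0 <= C by rewrite mulr_ge0// addr_ge0// ltW.
pose K := Num.sqrt (2 / m) + Num.sqrt C.
have K0 : 0 < K by rewrite ltr_pwDl ?sqrtr_gt0 ?divr_gt0// sqrtr_ge0.
exists K => //; have := gram_continuous ac cx e0; apply: filterS => y Gy v.
rewrite /tnorm inner_gram; set q := (v *m gram g c y *m v^T) 0 0.
have qlow : m / 2 * `|v| ^+ 2 <= q.
  have -> : q = (v *m gram g c x *m v^T) 0 0 + (v *m (gram g c y - gram g c x) *m v^T) 0 0.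
    by rewrite mulmxBr mulmxBl sub_mxE subrKC.
  have := mP v; have := quad_bound (gram g c y - gram g c x) v.
  rewrite ler_norml => /andP[+ _].
  have : n%:R ^+ 2 * `|gram g c y - gram g c x| * `|v| ^+ 2 <= m / 2 * `|v| ^+ 2.
    apply: ler_wpM2r; first by rewrite exprn_ge0.
    apply: le_trans (ler_wpM2l n20 Gy) _; rewrite mulrCA.
    apply: ler_piMr; first by rewrite divr_ge0 ?ltW.
    by rewrite ler_pdivrMr ?mul1r ?lerDl// ltr_wpDl.
  lra.
have qup : q <= C * `|v| ^+ 2.
  apply: le_trans (ler_norm _) _; apply: le_trans (quad_bound _ _) _.
  apply: ler_wpM2r; first by rewrite exprn_ge0.
  apply: ler_wpM2l => //; have := ler_normD (gram g c x) (gram g c y - gram g c x).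
  by rewrite subrKC; lra.
have q0 : 0 <= q by apply: le_trans qlow; rewrite mulr_ge0 ?exprn_ge0// divr_ge0// ltW.
have vE : `|v| = Num.sqrt (`|v| ^+ 2) by rewrite sqrtr_sqr normr_id.
split.
  apply: (@le_trans _ _ (Num.sqrt (2 / m) * Num.sqrt q)); last first.
    by rewrite ler_wpM2r ?sqrtr_ge0// lerDl sqrtr_ge0.
  have m2 : 0 <= 2 / m by rewrite divr_ge0// ltW.
  rewrite -sqrtrM// {1}vE ler_sqrt; last by rewrite mulr_ge0.
  by rewrite -ler_pdivrMl ?divr_gt0// invf_div.
apply: (@le_trans _ _ (Num.sqrt C * `|v|)); last first.
  by rewrite ler_wpM2r// lerDr sqrtr_ge0.
rewrite {1}vE -sqrtrM// ler_sqrt//; exact: le_trans qup.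
Qed.

End riemannian_norm.


(** * The hyperbolic splitting in charts *)

Section splitting.
Variables (R : realType) (n : nat) (M : topologicalType) (S : manifold R n M).
Variables (g : riemannian S) (L : set M) (Es Eu : M -> {vspace 'rV[R]_n}).
Implicit Types (c : chart R n M) (x y : M) (u v w : 'rV[R]_n).

Lemma from_chart_lin c y k (X : 'M[R]_(k, n)) (a : 'rV[R]_k) :
  from_chart S c y (a *m X) = \sum_i a 0 i *: from_chart S c y (row i X).
Proof.
rewrite from_chartE -mulmxA mulmx_sum_row; apply: eq_bigr => i _.
by rewrite from_chartE row_mul.
Qed.

(** A continuous subbundle as the row space of a continuous matrix, in the
coordinates of one chart. *)
Lemma local_frame (E : M -> {vspace 'rV[R]_n}) xi : continuous_subbundle S L E -> L xi ->
  exists (U : set M) (k : nat) (F : M -> 'M[R]_(k, n)),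
  [/\ open U /\ U xi, U `<=` cdom (chart_at S xi),
   (forall y, L y -> U y -> forall a : 'rV[R]_k,
      from_chart S (chart_at S xi) y (a *m F y) \in E y),
   (forall y, L y -> U y -> forall u, u \in E y ->
      exists a : 'rV[R]_k, u = from_chart S (chart_at S xi) y (a *m F y)) &
   (forall x, L x -> U x -> forall e : R, 0 < e ->
      \forall y \near x, L y -> `|F y - F x| <= e)].
Proof.
move=> cE Lxi; have [U [k [e [Uo Uxi Uc ec eb]]]] := cE _ Lxi.
exists U, k, (fun y => \matrix_i e i y); split => //.
- move=> y Ly Uy a; rewrite from_chart_lin memv_suml// => i _; rewrite memvZ//.
  rewrite rowK; apply: (basis_mem (eb y Ly Uy)).
  by apply/mapP; exists i => //; rewrite mem_enum.
- move=> y Ly Uy u; rewrite -(span_basis (eb y Ly Uy)) span_def big_map big_enum /=.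
  move=> /memv_sumP[us usP ->].
  have us_line i : exists b : R, us i = b *: from_chart S (chart_at S xi) y (e i y).
    by apply/vlineP; exact: usP.
  have [b bP] := choice us_line.
  exists (\row_i b i); rewrite from_chart_lin; apply: eq_bigr => i _.
  by rewrite mxE rowK.
- move=> x Lx Ux d d0.
  pose P i : set M := [set y | L y -> `|e i y - e i x| < d].
  have : \forall y \near x, forall i, P i y.
    apply: (filter_forall (nbhs_filter x)) => i.
    have /subspace_continuousP/(_ x (conj Lx Ux)) := ec i.
    move=> /cvgrPdistC_lt/(_ _ d0); rewrite near_withinE => H.
    have Unx : nbhs x U by exact: open_nbhs_nbhs.
    by apply: filterS (filterI Unx H) => y [Uy +] Ly; apply; split.
  apply: filterS => y Py Ly; apply: mx_norm_rows => [|i]; first exact: ltW.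
  by rewrite linearB /= !rowK; apply: ltW; exact: Py.
Qed.

(** A chart domain on which [P y], in the coordinates of [c], is the projection on
[Es y] along [Eu y], continuous along [L], and on which one constant [K] bounds
the projections and compares the norms. Matrices act on row vectors from the
right. *)
Record splitting_chart c (O : set M) (P : M -> 'M[R]_n) (K : R) : Prop := {
  sc_atlas : atlas S c;
  sc_open : open O;
  sc_dom : O `<=` cdom c;
  sc_tnorm : forall y, O y -> forall v, `|v| <= K * tnorm g y (from_chart S c y v) /\
    tnorm g y (from_chart S c y v) <= K * `|v|;
  sc_stable : forall y, L y -> O y -> forall v, from_chart S c y (v *m P y) \in Es y;
  sc_unstable : forall y, L y -> O y -> forall v,
    from_chart S c y (v *m (1%:M - P y)) \in Eu y;
  sc_boundP : forall y, L y -> O y -> forall v, `|v *m P y| <= K * `|v|;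
  sc_boundQ : forall y, L y -> O y -> forall v, `|v *m (1%:M - P y)| <= K * `|v|;
  sc_cont : forall x, L x -> O x -> forall e : R, 0 < e ->
    \forall y \near x, L y -> `|P y - P x| <= e }.

Hypotheses (contEs : continuous_subbundle S L Es) (contEu : continuous_subbundle S L Eu).
Hypothesis splitE : forall x, L x ->
  (Es x + Eu x)%VS = fullv /\ (Es x :&: Eu x)%VS = 0%VS.

(** With frames [Fs] and [Fu] of the two bundles, 1 = A Fs + B Fu at each point, and
the projection is A Fs. For its continuity, freeze A and B at x: the matrix
A Fs(y) + B Fu(y) is close to 1, and multiplied by P y it gives A Fs(y), which is
close to P x. *)
Lemma exists_splitting_chart xi : L xi -> exists O P K,
  [/\ O xi, 0 < K & splitting_chart (chart_at S xi) O P K].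
Proof.
move=> Lxi; pose c := chart_at S xi.
have ac : atlas S c := chart_at_atlas S xi.
have [Us [ks [Fs [[Uso Usx] Usc Fs_in Fs_span Fs_cont]]]] := local_frame contEs Lxi.
have [Uu [ku [Fu [[Uuo Uux] Uuc Fu_in Fu_span Fu_cont]]]] := local_frame contEu Lxi.
pose U := Us `&` Uu.
have disj y : L y -> U y -> forall m (X : 'M[R]_(m, ks)) (Y : 'M[R]_(m, ku)),
    X *m Fs y = Y *m Fu y -> X *m Fs y = 0.
  move=> Ly [Usy Uuy] m X Y XY; apply/row_matrixP => i; rewrite row_mul row0.
  have cy : cdom c y := Usc _ Usy.
  apply: (from_chart_inj ac cy); apply/eqP.
  rewrite -memv0 -(splitE Ly).2 memv_cap; apply/andP; split; first exact: Fs_in.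
  by rewrite -row_mul XY row_mul Fu_in.
have dec y : exists AB : 'M[R]_(n, ks) * 'M[R]_(n, ku),
    L y -> U y -> AB.1 *m Fs y + AB.2 *m Fu y = 1%:M.
  have [[Ly Uy]|nLU] := pselect (L y /\ U y); last first.
    by exists (0, 0) => Ly Uy; case: nLU.
  have [Usy Uuy] := Uy; have cy : cdom c y := Usc _ Usy.
  have rows i : exists ab : 'rV[R]_ks * 'rV[R]_ku,
      ab.1 *m Fs y + ab.2 *m Fu y = delta_mx 0 i.
    have : from_chart S c y (delta_mx 0 i) \in (Es y + Eu y)%VS.
      by rewrite (splitE Ly).1 memvf.
    move=> /memv_addP[u uE [w wE dE]].
    have [a ua] := Fs_span y Ly Usy u uE; have [b wb] := Fu_span y Ly Uuy w wE.
    exists (a, b); apply/eqP; rewrite -subr_eq0; apply/eqP.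
    apply: (from_chart_inj ac cy).
    move: dE; rewrite ua wb !from_chartE mulmxBl mulmxDl => ->.
    by rewrite subrr.
  have [ab abP] := choice rows.
  exists (\matrix_i (ab i).1, \matrix_i (ab i).2) => _ _ /=.
  by apply/row_matrixP => i; rewrite linearD /= !row_mul !rowK row1 abP.
have [AB ABP] := choice dec.
pose P y := (AB y).1 *m Fs y.
have PC y : L y -> U y -> 1%:M - P y = (AB y).2 *m Fu y.
  by move=> Ly Uy; rewrite -(ABP y Ly Uy) /P addrC addKr.
have FsP y : L y -> U y -> Fs y *m P y = Fs y.
  move=> Ly Uy; apply/eqP; rewrite -subr_eq0 -opprB oppr_eq0; apply/eqP.
  have -> : Fs y - Fs y *m P y = (1%:M - Fs y *m (AB y).1) *m Fs y.
    by rewrite mulmxBl mul1mx mulmxA.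
  apply: (disj y Ly Uy _ _ (Fs y *m (AB y).2)).
  rewrite -mulmxA -PC// mulmxBr mulmx1 mulmxBl mul1mx -[in LHS]mulmxA.
  by [].
have FuP y : L y -> U y -> Fu y *m P y = 0.
  move=> Ly Uy; rewrite /P mulmxA; apply: (disj y Ly Uy _ _ (1%:M - Fu y *m (AB y).2)).
  rewrite mulmxBl mul1mx -[in RHS]mulmxA -PC// mulmxBr mulmx1 opprB addrC subrK.
  by rewrite /P mulmxA.
have Pcont x : L x -> U x -> forall e : R, 0 < e ->
    \forall y \near x, L y -> `|P y - P x| <= e.
  move=> Lx Ux e e0; have [Usx' Uux'] := Ux.
  pose A := (AB x).1; pose B := (AB x).2.
  pose C : R := ks%:R * `|A| + ku%:R * `|B|.
  have C0 : 0 <= C by rewrite addr_ge0// mulr_ge0.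
  pose q : R := n%:R * `|P x| + 1; have q0 : 0 < q by rewrite ltr_wpDl// mulr_ge0.
  have n0 : 0 < n%:R + 1 :> R by rewrite ltr_wpDl.
  pose t : R := Num.min (2^-1 / (n%:R + 1)) (e / 2 / q).
  have t0 : 0 < t by rewrite lt_min !divr_gt0 ?invr_gt0.
  have C1 : 0 < C + 1 by rewrite ltr_wpDl.
  pose d : R := t / (C + 1); have d0 : 0 < d by rewrite divr_gt0.
  have nUx : nbhs x U by apply: open_nbhs_nbhs; split=> //; exact: openI.
  have H1 := Fs_cont x Lx Usx' d d0; have H2 := Fu_cont x Lx Uux' d d0.
  apply: filterS (filterI nUx (filterI H1 H2)) => y [Uy [+ +]] Ly.
  move=> /(_ Ly) hs /(_ Ly) hu.
  set D := P y - P x.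
  have DE : D = (A *m (Fs x - Fs y) + B *m (Fu x - Fu y)) *m P y + A *m (Fs y - Fs x).
    have -> : A *m (Fs x - Fs y) + B *m (Fu x - Fu y) = 1%:M - (A *m Fs y + B *m Fu y).
      by rewrite !mulmxBr addrACA -opprD ABP.
    rewrite mulmxBl mul1mx mulmxDl -!mulmxA FsP// FuP// mulmx0 addr0 mulmxBr.
    by rewrite /D addrA subrK.
  have Ad : ks%:R * `|A| * d + ku%:R * `|B| * d <= t.
    rewrite -mulrDl /d mulrA ler_pdivrMr// mulrC ler_wpM2l ?ltW//.
    by rewrite -/C ltrDl.
  have As : `|A *m (Fs y - Fs x)| <= ks%:R * `|A| * d.
    by apply: le_trans (mulmx_norm _ _) _; rewrite ler_wpM2l// mulr_ge0.
  have As' : `|A *m (Fs x - Fs y)| <= ks%:R * `|A| * d.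
    by apply: le_trans (mulmx_norm _ _) _; rewrite distrC ler_wpM2l// mulr_ge0.
  have Bu : `|B *m (Fu x - Fu y)| <= ku%:R * `|B| * d.
    by apply: le_trans (mulmx_norm _ _) _; rewrite distrC ler_wpM2l// mulr_ge0.
  have Bd0 : 0 <= ku%:R * `|B| * d by apply: mulr_ge0; [exact: mulr_ge0|exact: ltW].
  have Py : `|P y| <= `|P x| + `|D| by rewrite -[P y](subrKC (P x)) ler_normD.
  have D1 : `|D| <= n%:R * t * `|P y| + t.
    rewrite {1}DE; apply: le_trans (ler_normD _ _) _; apply: lerD; last by lra.
    apply: le_trans (mulmx_norm _ _) _; apply: ler_wpM2r => //; apply: ler_wpM2l => //.
    by apply: le_trans (ler_normD _ _) _; lra.
  have nt : n%:R * t <= 2^-1.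
    have : t * (n%:R + 1) <= 2^-1 by rewrite -ler_pdivlMr// ge_min lexx.
    have := ltW t0; rewrite mulrDr mulr1 mulrC; lra.
  have tq : t * q <= e / 2 by rewrite -ler_pdivlMr// ge_min lexx orbT.
  have D2 : n%:R * t * `|P y| <= n%:R * t * `|P x| + 2^-1 * `|D|.
    apply: (@le_trans _ _ (n%:R * t * (`|P x| + `|D|))).
      by rewrite ler_wpM2l// mulr_ge0// ltW.
    by rewrite mulrDr lerD2l ler_wpM2r.
  have tqE : t * q = n%:R * t * `|P x| + t by rewrite /q; ring.
  lra.
have Uxi : U xi by [].
have nU : nbhs xi U by apply: open_nbhs_nbhs; split=> //; exact: openI.
have [K1 K10 HK1] := tnorm_comparable g ac (chart_at_dom S xi).
have HP := Pcont xi Lxi Uxi 1 ltr01.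
pose K2 : R := n%:R * (`|P xi| + 1) + 1.
have K21 : 1 <= K2 by rewrite lerDr mulr_ge0// addr_ge0.
pose K := K1 + K2; pose O := interior (U `&` [set y |
  (forall v, `|v| <= K1 * tnorm g y (from_chart S c y v) /\
    tnorm g y (from_chart S c y v) <= K1 * `|v|) /\ (L y -> `|P y - P xi| <= 1)]).
have tn0 y v : 0 <= tnorm g y v by exact: sqrtr_ge0.
have OS y : O y -> U y by move=> /interior_subset[].
have Pbd y : L y -> O y -> forall v, `|v *m P y| + `|v| <= K2 * `|v|.
  move=> Ly /interior_subset[_ [_ /(_ Ly) Py]] v.
  have : `|P y| <= `|P xi| + 1.
    by rewrite -[P y](subrKC (P xi)); apply: le_trans (ler_normD _ _) _; lra.
  move=> /(ler_wpM2l (_ : 0 <= n%:R * `|v|)) H.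
  have := mulmx_norm v (P y); have := H _; rewrite mulr_ge0// => /(_ isT).
  by rewrite /K2; lra.
exists O, P, K; split.
- by apply: filterI => //; apply: filterI.
- by rewrite addr_gt0// (lt_le_trans ltr01).
- split => //.
  + exact: open_interior.
  + by move=> y /OS[/Usc].
  + move=> y /interior_subset[_ [Ky _]] v; have [h1 h2] := Ky v.
    have := tn0 y (from_chart S c y v); have := normr_ge0 v => v0 t0.
    split; [apply: le_trans h1 _|apply: le_trans h2 _]; rewrite ler_wpM2r// lerDl; lra.
  + by move=> y Ly /OS[Usy _] v; rewrite mulmxA; exact: Fs_in.
  + by move=> y Ly /OS Uy v; rewrite PC// mulmxA; apply: Fu_in => //; case: Uy.
  + move=> y Ly Oy v; have Pv := Pbd y Ly Oy v; have v0 : 0 <= `|v| by [].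
    have K1v : 0 <= K1 * `|v| by rewrite mulr_ge0// ltW.
    rewrite /K mulrDl; lra.
  + move=> y Ly Oy v; have Pv := Pbd y Ly Oy v; have v0 : 0 <= `|v| by [].
    have K1v : 0 <= K1 * `|v| by rewrite mulr_ge0// ltW.
    rewrite mulmxBr mulmx1; apply: le_trans (ler_normB _ _) _.
    by rewrite /K mulrDl; lra.
  + by move=> x Lx /OS Ux; exact: Pcont.
Qed.

End splitting.


(** * Local estimates for a strong hyperbolic map *)

Section perturbation.
Variables (R : realType) (n : nat).
Implicit Types (A B P Q : 'M[R]_n) (d e : 'rV[R]_n).

(** [d] is a difference of two points, [e] the difference of their images, and [Q]
the projection at a nearby point: the rate 1/8 of the linear map at the centre
leaves room for a rate 1/4 nearby. *)
Lemma contraction_perturb A P (K : R) : 0 < K ->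
  (forall v : 'rV[R]_n, `|v *m A *m P| <= 8^-1 * `|v|) ->
  (forall v : 'rV[R]_n, `|v *m P| <= K * `|v|) ->
  exists2 k0 : R, 0 < k0 & forall k d e Q, k <= k0 ->
    `|e - d *m A| <= k * `|d| -> `|Q - P| <= k -> `|e *m Q| <= 4^-1 * `|d|.
Proof.
move=> K0 contr bound.
pose C : R := n%:R * (n%:R * `|A| + 1).
have C0 : 0 <= C by rewrite mulr_ge0// addr_ge0// mulr_ge0.
have KC : 0 < K + C by rewrite ltr_pwDl.
exists (Num.min 1 (8^-1 / (K + C))) => [|k d e Q kk0 s_small Q_near].
  by rewrite lt_min ltr01 divr_gt0// invr_gt0.
have k0 : 0 <= k by apply: le_trans Q_near.
have k1 : k <= 1 by apply: le_trans kk0 _; rewrite ge_min lexx.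
have kC : k * (K + C) <= 8^-1.
  by rewrite -ler_pdivlMr//; apply: le_trans kk0 _; rewrite ge_min lexx orbT.
set s := e - d *m A in s_small; have eE : e = d *m A + s by rewrite subrKC.
have d0 : 0 <= `|d| by [].
have e_le : `|e| <= (n%:R * `|A| + 1) * `|d|.
  rewrite eE; apply: le_trans (ler_normD _ _) _.
  have := mulmx_norm d A; have : k * `|d| <= `|d| by rewrite ler_piMl.
  rewrite mulrDl mul1r [_ * _ * `|A|]mulrAC; lra.
have -> : e *m Q = d *m A *m P + s *m P + e *m (Q - P).
  by rewrite -mulmxDl -eE mulmxBr subrKC.
apply: le_trans (ler_normD _ _) _; apply: le_trans (lerD (ler_normD _ _) (lexx _)) _.
have h1 := contr d; have h2 := bound s.
have h3 : K * `|s| <= K * (k * `|d|) by rewrite ler_wpM2l// ltW.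
have h4 : `|e *m (Q - P)| <= k * C * `|d|.
  apply: le_trans (mulmx_norm _ _) _.
  apply: (@le_trans _ _ (n%:R * ((n%:R * `|A| + 1) * `|d|) * k)).
    by apply: ler_pM; rewrite ?mulr_ge0// ler_wpM2l.
  by rewrite le_eqVlt; apply/orP; left; apply/eqP; rewrite /C; ring.
have h5 : k * (K + C) * `|d| <= 8^-1 * `|d| by rewrite ler_wpM2r.
lra.
Qed.

(** Two points that differ by a stable vector have images that differ by a nearly
stable vector, since A maps the stable direction to itself. If the images also
differ by an unstable vector then the difference is small with respect to
itself, hence zero. *)
Lemma transverse_perturb A B P P' (K : R) : 0 < K ->
  A *m B = 1%:M -> A *m P' = P *m A ->
  (forall v : 'rV[R]_n, `|v *m P'| <= K * `|v|) ->
  exists2 k0 : R, 0 < k0 & forall k d e Q Q', k <= k0 ->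
    `|e - d *m A| <= k * `|d| -> `|Q - P| <= k -> `|Q' - P'| <= k ->
    d *m (1%:M - Q) = 0 -> e *m Q' = 0 -> d = 0.
Proof.
move=> K0 AB AP bound.
pose C : R := n%:R * `|B| * (n%:R * (n%:R * `|A| + 1) + K + n%:R * n%:R * `|A|).
have C0 : 0 <= C.
  apply: mulr_ge0; rewrite ?mulr_ge0//; do 2![apply: addr_ge0 => //];
    by rewrite ?mulr_ge0 ?addr_ge0 ?mulr_ge0// ltW.
have C1 : 0 < C + 1 by rewrite ltr_wpDl.
exists (Num.min 1 (2^-1 / (C + 1))) => [|k d e Q Q' kk0 s_small Q_near Q'_near dQ eQ'].
  by rewrite lt_min ltr01 divr_gt0// invr_gt0.
have k0 : 0 <= k by apply: le_trans Q_near.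
have k1 : k <= 1 by apply: le_trans kk0 _; rewrite ge_min lexx.
have kC : k * (C + 1) <= 2^-1.
  by rewrite -ler_pdivlMr//; apply: le_trans kk0 _; rewrite ge_min lexx orbT.
set s := e - d *m A in s_small; have eE : e = d *m A + s by rewrite subrKC.
have d0 : 0 <= `|d| by [].
have e_le : `|e| <= (n%:R * `|A| + 1) * `|d|.
  rewrite eE; apply: le_trans (ler_normD _ _) _.
  have := mulmx_norm d A; have : k * `|d| <= `|d| by rewrite ler_piMl.
  rewrite mulrDl mul1r [_ * _ * `|A|]mulrAC; lra.
have dQE : d = d *m Q.
  by apply/eqP; rewrite -subr_eq0 -{1}[d]mulmx1 -mulmxBr dQ.
have dA : d *m A = - (e *m (Q' - P')) - s *m P' + d *m (Q - P) *m A.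
  have -> : d *m (Q - P) *m A = d *m A - d *m A *m P'.
    by rewrite mulmxBr mulmxBl -dQE -[d *m A *m P']mulmxA AP mulmxA.
  have sP : s *m P' = e *m P' - d *m A *m P' by rewrite /s mulmxBl.
  by rewrite mulmxBr eQ' sub0r opprK sP opprB !subrKC.
have h1 : `|e *m (Q' - P')| <= k * (n%:R * (n%:R * `|A| + 1)) * `|d|.
  apply: le_trans (mulmx_norm _ _) _.
  apply: (@le_trans _ _ (n%:R * ((n%:R * `|A| + 1) * `|d|) * k)).
    by apply: ler_pM; rewrite ?mulr_ge0// ler_wpM2l.
  by rewrite le_eqVlt; apply/orP; left; apply/eqP; ring.
have h2 : `|s *m P'| <= k * K * `|d|.
  apply: le_trans (bound s) _; rewrite -mulrA mulrCA.
  by apply: ler_wpM2l; first exact: ltW.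
have h3 : `|d *m (Q - P) *m A| <= k * (n%:R * n%:R * `|A|) * `|d|.
  apply: le_trans (mulmx_norm _ _) _.
  apply: (@le_trans _ _ (n%:R * (n%:R * `|d| * k) * `|A|)).
    apply: ler_wpM2r => //; apply: ler_wpM2l => //.
    by apply: le_trans (mulmx_norm _ _) _; rewrite ler_wpM2l// mulr_ge0.
  by rewrite le_eqVlt; apply/orP; left; apply/eqP; ring.
have h4 : `|d *m A| <= k * (n%:R * (n%:R * `|A| + 1) + K + n%:R * n%:R * `|A|) * `|d|.
  rewrite dA; apply: le_trans (ler_normD _ _) _.
  apply: le_trans (lerD (ler_normB _ _) (lexx _)) _; rewrite normrN.
  by apply: le_trans (lerD (lerD h1 h2) h3) _; rewrite -!mulrDl -!mulrDr.
have h5 : `|d| <= k * C * `|d|.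
  rewrite -{1}[d]mulmx1 -AB mulmxA; apply: le_trans (mulmx_norm _ _) _.
  apply: le_trans (ler_wpM2r _ (ler_wpM2l _ h4)) _ => //.
  by rewrite le_eqVlt; apply/orP; left; apply/eqP; rewrite /C; ring.
have h6 : k * C * `|d| <= 2^-1 * `|d|.
  by rewrite ler_wpM2r//; apply: le_trans kC; rewrite ler_wpM2l// lerDl.
by apply/eqP; rewrite -normr_le0; lra.
Qed.

End perturbation.

Section pair_of_charts.
Variables (R : realType) (n : nat) (M : topologicalType) (S : manifold R n M).
Variables (g : riemannian S) (L : set M) (Es Eu : M -> {vspace 'rV[R]_n}).
Implicit Types (c : chart R n M) (x y : M) (u v w : 'rV[R]_n).

(** The differential maps the splitting at [x] to the splitting at [F x], hence it
commutes with the projections. *)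
Lemma chart_jacobian_splitting F x (c c' : chart R n M) (P P' : 'M[R]_n) : strict_map S F ->
  atlas S c -> atlas S c' -> cdom c x -> cdom c' (F x) ->
  (Es (F x) :&: Eu (F x))%VS = 0%VS ->
  (forall u, u \in Es x -> tangent_map S F x u \in Es (F x)) ->
  (forall u, u \in Eu x -> tangent_map S F x u \in Eu (F x)) ->
  (forall v, from_chart S c x (v *m P) \in Es x /\
     from_chart S c x (v *m (1%:M - P)) \in Eu x) ->
  (forall v, from_chart S c' (F x) (v *m P') \in Es (F x) /\
     from_chart S c' (F x) (v *m (1%:M - P')) \in Eu (F x)) ->
  chart_jacobian c c' F x *m P' = P *m chart_jacobian c c' F x.
Proof.
move=> sF ac ac' cx cFx disj FEs FEu PE P'E; set A := chart_jacobian c c' F x.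
have push v : from_chart S c' (F x) (v *m A) = tangent_map S F x (from_chart S c x v).
  by rewrite (tangent_map_from_chart _ sF ac ac').
suff E v : v *m (A *m P') = v *m (P *m A).
  by apply/row_matrixP => i; rewrite !rowE E.
apply/eqP; rewrite -subr_eq0; apply/eqP; apply: (from_chart_inj ac' cFx).
apply/eqP; rewrite -memv0 -disj memv_cap; apply/andP; split.
  rewrite from_chartE mulmxBl -!from_chartE mulmxA rpredB//; first exact: (P'E _).1.
  by rewrite mulmxA push FEs// (PE v).1.
have -> : v *m (A *m P') - v *m (P *m A) =
    v *m (1%:M - P) *m A - v *m A *m (1%:M - P').
  have -> : v *m (1%:M - P) *m A = v *m A - v *m P *m A.
    by rewrite mulmxBr mulmx1 mulmxBl.
  have -> : v *m A *m (1%:M - P') = v *m A - v *m A *m P' by rewrite mulmxBr mulmx1.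
  by rewrite !mulmxA opprB [RHS]addrC subrKA.
rewrite from_chartE mulmxBl -!from_chartE rpredB//; last exact: (P'E _).2.
by rewrite push FEu// (PE v).2.
Qed.

Lemma chart_jacobian_contraction (E : {vspace 'rV[R]_n}) F x (c c' : chart R n M)
    (P P' : 'M[R]_n) (K theta : R) : 0 < K -> 0 <= theta -> K ^+ 3 * theta <= 8^-1 ->
  strict_map S F -> atlas S c -> atlas S c' -> cdom c x -> cdom c' (F x) ->
  (forall v, tnorm g x (from_chart S c x v) <= K * `|v|) ->
  (forall v, `|v| <= K * tnorm g (F x) (from_chart S c' (F x) v)) ->
  (forall v, from_chart S c x (v *m P) \in E) ->
  (forall v, `|v *m P| <= K * `|v|) ->
  (forall u, u \in E -> tnorm g (F x) (tangent_map S F x u) <= theta * tnorm g x u) ->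
  chart_jacobian c c' F x *m P' = P *m chart_jacobian c c' F x ->
  forall v, `|v *m chart_jacobian c c' F x *m P'| <= 8^-1 * `|v|.
Proof.
move=> K0 th0 Kth sF ac ac' cx cFx up low PE bound contr comm v.
rewrite -mulmxA comm mulmxA; apply: le_trans (low _) _.
rewrite -(tangent_map_from_chart _ sF ac ac')//.
apply: le_trans (ler_wpM2l (ltW K0) (contr _ (PE v))) _.
have Kt : 0 <= K * theta by rewrite mulr_ge0// ltW.
rewrite mulrA; apply: le_trans (ler_wpM2l Kt (up _)) _.
apply: le_trans (ler_wpM2l Kt (ler_wpM2l (ltW K0) (bound v))) _.
apply: le_trans (ler_wpM2r _ Kth) => //.
by rewrite le_eqVlt; apply/orP; left; apply/eqP; ring.
Qed.

(** The map [F] read in the charts [c] and [c'], recentred at [y] and [y']: inside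
the chart domains it fixes the origin exactly when [F y = y']. *)
Definition local_map (c c' : chart R n M) (F : M -> M) y y' w :=
  cfun c' (F (cinv c (cfun c y + w))) - cfun c' y'.

Lemma near_chart_le c x (d : R) : cdom c x -> 0 < d ->
  \forall y \near x, `|cfun c y - cfun c x| <= d.
Proof.
move=> cx d0; have /cvgrPdistC_lt/(_ _ d0) := cfun_continuous cx.
by apply: filterS => y /ltW.
Qed.

End pair_of_charts.


Section local_estimates.
Variables (R : realType) (n : nat) (M : topologicalType) (S : manifold R n M).
Variables (g : riemannian S) (L : set M) (Es Eu : M -> {vspace 'rV[R]_n}).
Variables (F G : M -> M) (K theta : R).
Implicit Types (c : chart R n M) (x y : M) (u v w : 'rV[R]_n).

Hypotheses (FK : cancel F G) (GK : cancel G F).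
Hypotheses (sF : strict_map S F) (sG : strict_map S G).
Hypothesis FL : forall x, L x -> L (F x).
Hypothesis splitE : forall x, L x -> (Es x :&: Eu x)%VS = 0%VS.
Hypothesis FEs : forall x u, L x -> u \in Es x -> tangent_map S F x u \in Es (F x).
Hypothesis FEu : forall x u, L x -> u \in Eu x -> tangent_map S F x u \in Eu (F x).
Hypothesis GEs : forall x u, L x -> u \in Es (F x) -> tangent_map S G (F x) u \in Es x.
Hypothesis GEu : forall x u, L x -> u \in Eu (F x) -> tangent_map S G (F x) u \in Eu x.
Hypotheses (K0 : 0 < K) (theta0 : 0 <= theta) (Ktheta : K ^+ 3 * theta <= 8^-1).
Hypothesis F_contr : forall x u, L x -> u \in Es x ->
  tnorm g (F x) (tangent_map S F x u) <= theta * tnorm g x u.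
Hypothesis G_contr : forall x u, L x -> u \in Eu (F x) ->
  tnorm g x (tangent_map S G (F x) u) <= theta * tnorm g (F x) u.

(** What a link of a chain must satisfy at scale [r]: contraction of the stable
parts forwards and of the unstable parts backwards, and transversality. *)
Record chain_estimates (c c' : chart R n M) (P P' : M -> 'M[R]_n) (r : R) y y' : Prop := {
  ce_fwd : forall v w, `|v| <= r -> `|w| <= r ->
    `|(local_map c c' F y y' v - local_map c c' F y y' w) *m P' y'| <= 4^-1 * `|v - w|;
  ce_bwd : forall v w, `|v| <= r -> `|w| <= r ->
    `|(local_map c' c G y' y v - local_map c' c G y' y w) *m (1%:M - P y)|
      <= 4^-1 * `|v - w|;
  ce_transverse : forall v w, `|v| <= r -> `|w| <= r ->
    (v - w) *m (1%:M - P y) = 0 ->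
    (local_map c c' F y y' v - local_map c c' F y y' w) *m P' y' = 0 -> v = w;
  ce_dom : forall w, `|w| <= r ->
    ccod c (cfun c y + w) /\ cdom c' (F (cinv c (cfun c y + w))) }.

(** The scale [rho] on which the backward map stays in the domain of the
estimates, is a right inverse of the forward map, and moves points by less than
the wanted precision [W]. *)
Record chain_orbits (c c' : chart R n M) (W : set (M * M)) (r rho : R) y y' : Prop := {
  co_back : forall w, `|w| <= rho -> `|local_map c' c G y' y w| <= r;
  co_cancel : forall w, `|w| <= rho ->
    local_map c c' F y y' (local_map c' c G y' y w) = w;
  co_close : forall w, `|w| <= rho -> W (cinv c (cfun c y + w), y) }.

Lemma strict_diff_local c c' (H : M -> M) x (k : R) : strict_map S H ->
  atlas S c -> atlas S c' -> cdom c x -> cdom c' (H x) -> 0 < k ->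
  exists2 r : R, 0 < r & forall y y' v w, `|cfun c y - cfun c x| <= r ->
    `|v| <= r -> `|w| <= r ->
    `|local_map c c' H y y' v - local_map c c' H y y' w - (v - w) *m chart_jacobian c c' H x|
      <= k * `|v - w|.
Proof.
move=> sH ac ac' cx cHx k0; have [d d0 dP] := sH.2 x c c' ac ac' cx cHx k k0.
exists (d / 3) => [|y y' v w yx vr wr]; first by rewrite divr_gt0.
have d3 : d / 3 + d / 3 < d by lra.
have near t : `|t| <= d / 3 -> `|cfun c y + t - cfun c x| < d.
  move=> tr; apply: le_lt_trans d3; rewrite addrAC.
  by apply: le_trans (ler_normD _ _) _; exact: lerD.
have := dP _ _ (near _ vr) (near _ wr).
have -> : cfun c y + v - (cfun c y + w) = v - w by rewrite opprD addrACA subrr add0r.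
by rewrite /local_map opprB subrKA.
Qed.

Lemma inverse_chart_jacobian c c' x : atlas S c -> atlas S c' -> cdom c x -> cdom c' (F x) ->
  chart_jacobian c c' F x *m chart_jacobian c' c G (F x) = 1%:M.
Proof.
move=> ac ac' cx cFx; rewrite -(@chart_jacobian_comp _ _ _ S F G)// ?FK//.
by rewrite (_ : G \o F = id) ?chart_jacobian_id//; apply/funext.
Qed.

(** All estimates are perturbed from the pair ([x], [F x]), where they hold for the
linear maps with the exact splittings. *)
Lemma chain_estimates_near c c' O O' P P' x :
  splitting_chart g L Es Eu c O P K -> splitting_chart g L Es Eu c' O' P' K ->
  L x -> O x -> O' (F x) ->
  exists2 r : R, 0 < r & \forall y \near x & y' \near F x,
    L y -> L y' -> chain_estimates c c' P P' r y y'.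
Proof.
move=> sc sc' Lx Ox Ox'; have LFx := FL Lx.
have ac := sc_atlas sc; have ac' := sc_atlas sc'.
have cx := sc_dom sc Ox; have cFx := sc_dom sc' Ox'.
set A := chart_jacobian c c' F x; set B := chart_jacobian c' c G (F x).
have PE v : from_chart S c x (v *m P x) \in Es x /\
    from_chart S c x (v *m (1%:M - P x)) \in Eu x.
  by split; [exact: (sc_stable sc)|exact: (sc_unstable sc)].
have P'E v : from_chart S c' (F x) (v *m P' (F x)) \in Es (F x) /\
    from_chart S c' (F x) (v *m (1%:M - P' (F x))) \in Eu (F x).
  by split; [exact: (sc_stable sc')|exact: (sc_unstable sc')].
have AP : A *m P' (F x) = P x *m A.
  apply: (chart_jacobian_splitting sF ac ac' cx cFx (splitE LFx)) => // u; [exact: FEs|exact: FEu].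
have cGFx : cdom c (G (F x)) by rewrite FK.
have BP : B *m P x = P' (F x) *m B.
  apply: (chart_jacobian_splitting sG ac' ac cFx cGFx); rewrite ?FK//; first exact: splitE.
    by move=> u; exact: GEs.
  by move=> u; exact: GEu.
have BQ : B *m (1%:M - P x) = (1%:M - P' (F x)) *m B.
  by rewrite mulmxBr mulmx1 BP mulmxBl mul1mx.
have contrA v : `|v *m A *m P' (F x)| <= 8^-1 * `|v|.
  apply: (chart_jacobian_contraction K0 theta0 Ktheta sF ac ac' cx cFx
    (E := Es x) (P := P x) (g := g)) => // w.
  - exact: (sc_tnorm sc Ox w).2.
  - exact: (sc_tnorm sc' Ox' w).1.
  - exact: (PE w).1.
  - exact: (sc_boundP sc).
  - exact: F_contr.
have contrB v : `|v *m B *m (1%:M - P x)| <= 8^-1 * `|v|.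
  apply: (chart_jacobian_contraction K0 theta0 Ktheta sG ac' ac cFx cGFx (E := Eu (F x))
    (P := 1%:M - P' (F x)) (g := g)) => // w; rewrite ?FK.
  - exact: (sc_tnorm sc' Ox' w).2.
  - exact: (sc_tnorm sc Ox w).1.
  - exact: (P'E w).2.
  - exact: (sc_boundQ sc').
  - by move=> wE; apply: G_contr.
have [k1 k10 k1P] := contraction_perturb K0 contrA (sc_boundP sc' LFx Ox').
have [k2 k20 k2P] := contraction_perturb K0 contrB (sc_boundQ sc Lx Ox).
have [k3 k30 k3P] := transverse_perturb K0 (inverse_chart_jacobian ac ac' cx cFx) AP
  (sc_boundP sc' LFx Ox').
pose k := Num.min k1 (Num.min k2 k3).
have k0 : 0 < k by rewrite !lt_min k10 k20.
have kk1 : k <= k1 by rewrite ge_min lexx.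
have kk2 : k <= k2 by rewrite /k !ge_min lexx !orbT.
have kk3 : k <= k3 by rewrite /k !ge_min lexx !orbT.
have [r1 r10 r1P] := strict_diff_local sF ac ac' cx cFx k0.
have [r2 r20 r2P] := strict_diff_local sG ac' ac cFx cGFx k0.
have /nbhs_ballP[d d0 dP] := near_cdom sF.1 cx cFx.
pose r := Num.min r1 (Num.min r2 (d / 3)).
have d30 : 0 < d / 3 by rewrite divr_gt0.
have r0 : 0 < r by rewrite !lt_min r10 r20.
have rr1 : r <= r1 by rewrite ge_min lexx.
have rr2 : r <= r2 by rewrite /r !ge_min lexx !orbT.
have rd : r <= d / 3 by rewrite /r !ge_min lexx !orbT.
exists r => //.
exists ([set y | `|cfun c y - cfun c x| <= r /\ (L y -> `|P y - P x| <= k)],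
        [set y' | `|cfun c' y' - cfun c' (F x)| <= r /\ (L y' -> `|P' y' - P' (F x)| <= k)]).
  split => /=; apply: filterI.
  - exact: near_chart_le.
  - exact: (sc_cont sc).
  - exact: near_chart_le.
  - exact: (sc_cont sc').
move=> [y y'] /= [[yx Pyx] [yx' Pyx']] Ly Ly'.
have {}Pyx := Pyx Ly; have {}Pyx' := Pyx' Ly'.
have DF v w : `|v| <= r -> `|w| <= r -> `|local_map c c' F y y' v -
    local_map c c' F y y' w - (v - w) *m A| <= k * `|v - w|.
  by move=> vr wr; apply: r1P; apply: le_trans rr1.
have DG v w : `|v| <= r -> `|w| <= r -> `|local_map c' c G y' y v -
    local_map c' c G y' y w - (v - w) *m B| <= k * `|v - w|.
  by move=> vr wr; apply: r2P; apply: le_trans rr2.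
split => [v w vr wr|v w vr wr|v w vr wr vw hvw|w wr].
- exact: k1P kk1 (DF _ _ vr wr) Pyx'.
- apply: k2P kk2 (DG _ _ vr wr) _.
  by rewrite opprB addrC subrKA distrC.
- apply/eqP; rewrite -subr_eq0; apply/eqP.
  exact: k3P kk3 (DF _ _ vr wr) Pyx Pyx' vw hvw.
- apply: dP; rewrite -ball_normE /= distrC addrAC.
  apply: le_lt_trans (ler_normD _ _) _.
  have := le_trans yx rd; have := le_trans wr rd; lra.
Qed.

Lemma chain_orbits_near c c' (W : set (M * M)) (r : R) x :
  cdom c x -> cdom c' (F x) -> diag_nbhs W -> 0 < r ->
  exists2 rho : R, 0 < rho & \forall y \near x & y' \near F x,
    cdom c y -> cdom c' y' -> chain_orbits c c' W r rho y y'.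
Proof.
move=> cx cFx dW r0; have cGFx : cdom c (G (F x)) by rewrite FK.
have [[A B] /= [Ax Bx] AB] := dW x.
have contG : {for cfun c' (F x), continuous (cfun c \o G \o cinv c')}.
  apply: continuous_comp; first exact: cinv_continuous (cfun_cod cFx).
  apply: continuous_comp; first exact: sG.1.
  by apply: cfun_continuous; rewrite cfunK.
have r2 : 0 < r / 2 by rewrite divr_gt0.
have /cvgrPdistC_lt/(_ _ r2) := contG; rewrite /= cfunK// FK => nearG.
have nearA : nbhs (cfun c x) (cinv c @^-1` A).
  by apply: (cinv_continuous (cfun_cod cx)); rewrite cfunK.
have : nbhs (cfun c' (F x)) ([set z | ccod c' z /\ cdom c (G (cinv c' z))] `&`
   [set z | `|cfun c (G (cinv c' z)) - cfun c x| < r / 2]).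
  by apply: filterI; [exact: near_cdom sG.1 _ _|exact: nearG].
move=> /nbhs_ballP[d1 d10 d1P]; move/nbhs_ballP: nearA => [d2 d20 d2P].
pose rho := Num.min (d1 / 3) (Num.min (d2 / 3) (r / 2)).
have d13 : 0 < d1 / 3 by rewrite divr_gt0.
have d23 : 0 < d2 / 3 by rewrite divr_gt0.
have rho0 : 0 < rho by rewrite !lt_min d13 d23.
have rd1 : rho <= d1 / 3 by rewrite ge_min lexx.
have rd2 : rho <= d2 / 3 by rewrite /rho !ge_min lexx !orbT.
have rr : rho <= r / 2 by rewrite /rho !ge_min lexx !orbT.
exists rho => //.
exists (B `&` [set y | `|cfun c y - cfun c x| <= rho],
        [set y' | `|cfun c' y' - cfun c' (F x)| <= rho]).
  by split => /=; [apply: filterI => //; exact: near_chart_le|exact: near_chart_le].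
move=> [y y'] /= [[By yx] yx'] cy cy'.
have in1 w : `|w| <= rho -> [/\ ccod c' (cfun c' y' + w), cdom c (G (cinv c' (cfun c' y' + w))) &
    `|cfun c (G (cinv c' (cfun c' y' + w))) - cfun c x| < r / 2].
  move=> wr; have [|[h1 h2] h3] := d1P (cfun c' y' + w); last by split.
  rewrite -ball_normE /= distrC addrAC; apply: le_lt_trans (ler_normD _ _) _.
  have := le_trans yx' rd1; have := le_trans wr rd1; lra.
split => w wr; have [h1 h2 h3] := in1 w wr.
- rewrite /local_map -(subrKA (cfun c x)).
  apply: le_trans (ler_normD _ _) _; rewrite [`|cfun c x - _|]distrC.
  have := le_trans yx rr; lra.
- by rewrite /local_map subrKC cfunK// GK cinvK// addrC addKr.
- apply: AB; split => //=; apply: d2P.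
  rewrite -ball_normE /= distrC addrAC; apply: le_lt_trans (ler_normD _ _) _.
  have := le_trans yx rd2; have := le_trans wr rd2; lra.
Qed.

Lemma chain_closing_near c c' (e : R) x : cdom c x -> cdom c' (F x) -> 0 < e ->
  \forall y \near x & y' \near F x, cdom c y -> cdom c' y' ->
    `|local_map c c' F y y' 0| <= e /\ `|local_map c' c G y' y 0| <= e.
Proof.
move=> cx cFx e0; have e2 : 0 < e / 2 by rewrite divr_gt0.
have cGFx : cdom c (G (F x)) by rewrite FK.
have H1 : \forall y \near x, `|cfun c' (F y) - cfun c' (F x)| <= e / 2.
  exact: (sF.1 x _ (near_chart_le cFx e2)).
have H2 : \forall y' \near F x, `|cfun c (G y') - cfun c (G (F x))| <= e / 2.
  exact: (sG.1 (F x) _ (near_chart_le cGFx e2)).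
have H3 := near_chart_le cx e2; have H4 := near_chart_le cFx e2.
exists ([set y | `|cfun c' (F y) - cfun c' (F x)| <= e / 2 /\ `|cfun c y - cfun c x| <= e / 2],
  [set y' | `|cfun c (G y') - cfun c (G (F x))| <= e / 2 /\
     `|cfun c' y' - cfun c' (F x)| <= e / 2]).
  by split => /=; exact: filterI.
move=> [y y'] /= [[h1 h3] [h2 h4]] cy cy'; rewrite /local_map !addr0 !cfunK//.
rewrite FK in h2; split.
  rewrite -(subrKA (cfun c' (F x))); apply: le_trans (ler_normD _ _) _.
  by rewrite [`|cfun c' (F x) - _|]distrC; lra.
rewrite -(subrKA (cfun c x)); apply: le_trans (ler_normD _ _) _.
by rewrite [`|cfun c x - _|]distrC; lra.
Qed.

End local_estimates.


(** * Periodic shadowing *)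

Section splitting_atlas.
Variables (R : realType) (n : nat) (M : topologicalType) (S : manifold R n M).
Variables (g : riemannian S) (L : set M) (Es Eu : M -> {vspace 'rV[R]_n}).
Implicit Types (c : chart R n M) (x y : M).

Lemma splitting_chart_le c O P (K K' : R) : K <= K' ->
  splitting_chart g L Es Eu c O P K -> splitting_chart g L Es Eu c O P K'.
Proof.
move=> KK' [h1 h2 h3 h4 h5 h6 h7 h8 h9]; split => // y.
- move=> Oy v; have [l u] := h4 y Oy v.
  have t0 : 0 <= tnorm g y (from_chart S c y v) by exact: sqrtr_ge0.
  by split; [apply: le_trans l _|apply: le_trans u _]; exact: ler_wpM2r.
- by move=> Ly Oy v; apply: le_trans (h7 y Ly Oy v) _; exact: ler_wpM2r.
- by move=> Ly Oy v; apply: le_trans (h8 y Ly Oy v) _; exact: ler_wpM2r.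
Qed.

Lemma splitting_chart_idem c O P (K : R) y : (Es y :&: Eu y)%VS = 0%VS ->
  splitting_chart g L Es Eu c O P K -> L y -> O y -> P y *m P y = P y.
Proof.
move=> disj sc Ly Oy; suff E (v : 'rV[R]_n) : v *m (P y *m (1%:M - P y)) = 0.
  have : P y *m (1%:M - P y) = 0 by apply/row_matrixP => i; rewrite rowE E row0.
  by rewrite mulmxBr mulmx1 => /eqP; rewrite subr_eq0 => /eqP.
apply: (from_chart_inj (sc_atlas sc) (sc_dom sc Oy)); apply/eqP.
rewrite -memv0 -disj memv_cap mulmxA (sc_unstable sc Ly Oy) andbT.
rewrite from_chartE mulmxBr mulmx1 mulmxBl -!from_chartE rpredB//; exact: (sc_stable sc).
Qed.

Hypotheses (Mcompact : compact [set: M]) (clL : closed L).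
Hypotheses (contEs : continuous_subbundle S L Es) (contEu : continuous_subbundle S L Eu).
Hypothesis splitE : forall x, L x ->
  (Es x + Eu x)%VS = fullv /\ (Es x :&: Eu x)%VS = 0%VS.

(** The closed sets [V xi] inside the domains [O xi] make the finitely many charts
usable up to the boundary of the pieces assigned to them. *)
Lemma splitting_atlas : exists (D : seq M) (O V : M -> set M) (P : M -> M -> 'M[R]_n) (K : R),
  [/\ 0 < K,
   (forall xi, xi \in D -> splitting_chart g L Es Eu (chart_at S xi) (O xi) (P xi) K),
   (forall xi, closed (V xi) /\ V xi `<=` O xi) &
   (forall y, L y -> exists2 xi, xi \in D & V xi y)].
Proof.
have haus := manifold_hausdorff S.
have loc xi : exists T : set M * set M * (M -> 'M[R]_n) * R,
    [/\ nbhs xi T.1.1.2, (closed T.1.1.2 /\ T.1.1.2 `<=` T.1.1.1) \/ ~ L xi, 0 < T.2 &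
      (L xi -> splitting_chart g L Es Eu (chart_at S xi) T.1.1.1 T.1.2 T.2) /\
      (~ L xi -> T.1.1.2 `<=` ~` L)].
  have [Lxi|nL] := pselect (L xi); last first.
    exists (set0, ~` L, fun=> 0, 1); split => //=.
    - by apply: open_nbhs_nbhs; split => //; rewrite openC.
    - by right.
    - by split => [Lxi|_] //; case: (nL Lxi).
  have [N [P [K [Nxi K0 sc]]]] := exists_splitting_chart g contEs contEu splitE Lxi.
  have nN : nbhs xi N by apply: open_nbhs_nbhs; split => //; exact: sc_open sc.
  have [V Vxi VO] := compact_regular haus Mcompact (filterT : nbhs xi setT) nN.
  exists (N, closure V, P, K); split => //=.
  - by apply: filterS Vxi; exact: subset_closure.
  - by left; split => //; exact: closed_closure.
have [T TP] := choice loc.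
have Vnbhs xi : nbhs xi (T xi).1.1.2 by have [] := TP xi.
have [D [W [dW DW]]] := lebesgue_cover Mcompact haus Vnbhs.
have [K K0 KD] : exists2 K : R, 0 < K & forall xi, xi \in D -> (T xi).2 <= K.
  elim: D {DW} => [|xi D [K K0 KD]]; first by exists 1.
  exists (Num.max (T xi).2 K); first by rewrite lt_max K0 orbT.
  by move=> q; rewrite inE le_max => /predU1P[->|/KD ->]; rewrite ?lexx ?orbT.
pose V xi := if `[< L xi >] then (T xi).1.1.2 else set0.
exists [seq xi <- D | `[< L xi >]], (fun xi => (T xi).1.1.1), V, (fun xi => (T xi).1.2), K.
split => //.
- move=> xi; rewrite mem_filter => /andP[/asboolP Lxi xiD].
  have [_ _ _ [/(_ Lxi) sc _]] := TP xi.
  exact: splitting_chart_le (KD _ xiD) sc.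
- move=> xi; rewrite /V; case: asboolP => Lxi; last by split; [exact: closed0|].
  by have [_ []] := TP xi.
- move=> y Ly; have [xi xiD Vy] := DW y.
  have {}Vy : (T xi).1.1.2 y by apply: Vy; left; exact: diag_nbhs_refl.
  have Lxi : L xi.
    by apply: contrapT => nL; have [_ _ _ [_ /(_ nL)/(_ y Vy)]] := TP xi.
  exists xi; first by rewrite mem_filter xiD andbT; exact/asboolP.
  by rewrite /V asboolT.
Qed.

End splitting_atlas.

Section shadowing.
Variables (R : realType) (n : nat) (M : topologicalType) (S : manifold R n M).
Variables (g : riemannian S) (L : set M) (Es Eu : M -> {vspace 'rV[R]_n}).
Variables (F G : M -> M) (K theta : R).
Implicit Types (c : chart R n M) (x y : M) (u v w : 'rV[R]_n).
Hypotheses (Mcompact : compact [set: M]) (clL : closed L).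
Hypotheses (FK : cancel F G) (GK : cancel G F).
Hypotheses (sF : strict_map S F) (sG : strict_map S G).
Hypothesis FL : forall x, L x -> L (F x).
Hypothesis splitE : forall x, L x -> (Es x :&: Eu x)%VS = 0%VS.
Hypothesis FEs : forall x u, L x -> u \in Es x -> tangent_map S F x u \in Es (F x).
Hypothesis FEu : forall x u, L x -> u \in Eu x -> tangent_map S F x u \in Eu (F x).
Hypothesis GEs : forall x u, L x -> u \in Es (F x) -> tangent_map S G (F x) u \in Es x.
Hypothesis GEu : forall x u, L x -> u \in Eu (F x) -> tangent_map S G (F x) u \in Eu x.
Hypotheses (K0 : 0 < K) (theta0 : 0 <= theta) (Ktheta : K ^+ 3 * theta <= 8^-1).
Hypothesis F_contr : forall x u, L x -> u \in Es x ->
  tnorm g (F x) (tangent_map S F x u) <= theta * tnorm g x u.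
Hypothesis G_contr : forall x u, L x -> u \in Eu (F x) ->
  tnorm g x (tangent_map S G (F x) u) <= theta * tnorm g (F x) u.

Variables (D : seq M) (O V : M -> set M) (P : M -> M -> 'M[R]_n).
Hypothesis DP : forall xi, xi \in D ->
  splitting_chart g L Es Eu (chart_at S xi) (O xi) (P xi) K.
Hypothesis VO : forall xi, closed (V xi) /\ V xi `<=` O xi.
Hypothesis Vcover : forall y, L y -> exists2 xi, xi \in D & V xi y.

(** Only pairs of charts whose pieces contain the two points matter: a point outside
the closed set [V xi] has a neighbourhood outside it. *)
Let uniform_pairs (E : M -> M -> R -> M -> M -> Prop) :
  (forall xi xi' r s y y', 0 < s <= r -> E xi xi' r y y' -> E xi xi' s y y') ->
  (forall xi xi' x, xi \in D -> xi' \in D -> L x -> O xi x -> O xi' (F x) ->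
    exists2 r, 0 < r & \forall y \near x & y' \near F x,
      L y -> L y' -> O xi y -> O xi' y' -> E xi xi' r y y') ->
  exists2 r, 0 < r & exists2 W, diag_nbhs W & forall xi xi' y y',
    xi \in D -> xi' \in D -> L y -> L y' -> V xi y -> V xi' y' -> W (F y, y') ->
    E xi xi' r y y'.
Proof.
move=> Emono Eloc; have haus := manifold_hausdorff S.
have one (i : M * M) : i \in [seq (a, b) | a <- D, b <- D] ->
    exists2 r, 0 < r & exists2 W, diag_nbhs W & forall y y', L y -> L y' ->
      W (F y, y') -> V i.1 y -> V i.2 y' -> E i.1 i.2 r y y'.
  case/allpairsP => -[xi xi'] /= [xiD xiD' ->] /=.
  apply: (@uniform_on_graph M Mcompact haus R L F G
    (fun r y y' => V xi y -> V xi' y' -> E xi xi' r y y')) => //.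
  - exact: sG.1.
  - by move=> r s y y' sr H Vy Vy'; apply: Emono sr _; exact: H.
  - move=> x Lx.
    have [Vx|nVx] := pselect (V xi x); last first.
      exists 1 => //; exists (~` V xi, setT) => /=.
        split; last exact: filterT.
        by apply: open_nbhs_nbhs; split=> //; rewrite openC; exact: (VO _).1.
      by move=> [y y'] /= [nV _].
    have [Vx'|nVx'] := pselect (V xi' (F x)); last first.
      exists 1 => //; exists (setT, ~` V xi') => /=.
        split; first exact: filterT.
        by apply: open_nbhs_nbhs; split=> //; rewrite openC; exact: (VO _).1.
      by move=> [y y'] /= [_ nV].
    have [r r0 [[A B] AB EAB]] := Eloc xi xi' x xiD xiD' Lx ((VO _).2 _ Vx) ((VO _).2 _ Vx').
    exists r => //; exists (A, B) => // -[y y'] ABy Ly Ly' Vy Vy'.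
    by apply: (EAB (y, y')) => //; exact: (VO _).2.
have [r r0 [W dW H]] : exists2 r, 0 < r & exists2 W, diag_nbhs W &
    forall i, i \in [seq (a, b) | a <- D, b <- D] -> forall y y', L y -> L y' ->
      W (F y, y') -> V i.1 y -> V i.2 y' -> E i.1 i.2 r y y'.
  elim: [seq (a, b) | a <- D, b <- D] one => [|i s IH] one.
    by exists 1 => //; exists setT => //; exact: diag_nbhsT.
  have [r r0 [W dW rW]] := one i (mem_head _ _).
  have [|r' r0' [W' dW' rW']] := IH; first by move=> j js; apply: one; rewrite inE js orbT.
  have m0 : 0 < Num.min r r' by rewrite lt_min r0.
  exists (Num.min r r') => //; exists (W `&` W'); first exact: diag_nbhsI.
  move=> j; rewrite inE => /predU1P[->|js] y y' Ly Ly' [Wy Wy'] Vy Vy'.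
    by apply: (Emono _ _ r); [rewrite m0 ge_min lexx|exact: rW].
  by apply: (Emono _ _ r'); [rewrite m0 ge_min lexx orbT|exact: rW'].
exists r => //; exists W => // xi xi' y y' xiD xiD' Ly Ly' Vy Vy' Wy.
apply: (H (xi, xi')) => //; apply/allpairsP; exists (xi, xi'); split => //.
Qed.

(** The scales are chosen in turn: [r] for the estimates, then [rho] for the orbit,
then the size [e] of the jumps, whose projections are then at most rho / 4. *)
Lemma strong_periodic_shadowing (W : set (M * M)) : diag_nbhs W ->
  exists2 U, diag_nbhs U & forall p (x : 'I_p -> M),
    (forall i, L (x i)) -> (forall i, U (F (x i), x (ordS i))) ->
    exists z : 'I_p -> M, forall i, F (z i) = z (ordS i) /\ W (z i, x i).
Proof.
move=> dW; pose c xi := chart_at S xi.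
have [||r r0 [U1 dU1 H1]] := @uniform_pairs (fun xi xi' =>
    chain_estimates F G (c xi) (c xi') (P xi) (P xi')).
- move=> xi xi' r s y y' /andP[_ sr] [a1 a2 a3 a4].
  by split=> [v w vs ws|v w vs ws|v w vs ws|w ws];
    [apply: a1|apply: a2|apply: a3|apply: a4]; apply: le_trans sr.
- move=> xi xi' x xiD xiD' Lx Ox Ox'.
  have [r r0 [AB ABx H]] := chain_estimates_near FK sF sG FL splitE FEs FEu GEs GEu
    K0 theta0 Ktheta F_contr G_contr (DP xiD) (DP xiD') Lx Ox Ox'.
  by exists r => //; exists AB => // p /H {}H Ly Ly' _ _; exact: H.
have [||rho1 rho10 [U2 dU2 H2]] := @uniform_pairs (fun xi xi' =>
    chain_orbits F G (c xi) (c xi') W r).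
- move=> xi xi' t s y y' /andP[_ st] [a1 a2 a3].
  by split=> w ws; [apply: a1|apply: a2|apply: a3]; apply: le_trans st.
- move=> xi xi' x xiD xiD' Lx Ox Ox'.
  have dom := sc_dom (DP xiD); have dom' := sc_dom (DP xiD').
  have [t t0 [AB ABx H]] := chain_orbits_near FK GK sG (dom _ Ox) (dom' _ Ox') dW r0.
  by exists t => //; exists AB => // p /H {}H _ _ /dom ? /dom' ?; exact: H.
pose rho := Num.min rho1 r; have rho0 : 0 < rho by rewrite lt_min rho10.
have rhor : rho <= r by rewrite ge_min lexx orbT.
have rho_1 : rho <= rho1 by rewrite ge_min lexx.
pose e := rho / 4 / K; have e0 : 0 < e by rewrite !divr_gt0.
have [||t _ [U3 dU3 H3]] := @uniform_pairs (fun xi xi' (_ : R) y y' =>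
    `|local_map (c xi) (c xi') F y y' 0| <= e /\ `|local_map (c xi') (c xi) G y' y 0| <= e).
- by [].
- move=> xi xi' x xiD xiD' Lx Ox Ox'.
  have dom := sc_dom (DP xiD); have dom' := sc_dom (DP xiD').
  have [AB ABx H] := chain_closing_near FK sF sG (dom _ Ox) (dom' _ Ox') e0.
  by exists 1 => //; exists AB => // p /H {}H _ _ /dom ? /dom' ?; exact: H.
exists (U1 `&` (U2 `&` U3)); first by do 2![apply: diag_nbhsI => //].
move=> p x Lx Ux.
have [xi xiP] := choice (fun i => let: ex_intro2 a b d := Vcover (Lx i) in
  ex_intro (fun a => a \in D /\ V a (x i)) a (conj b d)).
have xiD i : xi i \in D := (xiP i).1.
have Vx i : V (xi i) (x i) := (xiP i).2.
have Ox i : O (xi i) (x i) := (VO _).2 _ (Vx i).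
pose c_ i := c (xi i).
have E1 i : chain_estimates F G (c_ i) (c_ (ordS i)) (P (xi i)) (P (xi (ordS i))) r
    (x i) (x (ordS i)) by apply: H1 => //; case: (Ux i).
have E2 i : chain_orbits F G (c_ i) (c_ (ordS i)) W r rho1 (x i) (x (ordS i)).
  by apply: H2 => //; case: (Ux i) => _ [].
have E3 i := H3 _ _ _ _ (xiD i) (xiD (ordS i)) (Lx i) (Lx (ordS i)) (Vx i) (Vx _)
  (Ux i).2.2.
have Ke : K * e = rho / 4 by rewrite /e mulrC divfK// gt_eqF.
have [|||||||w wP] := @hyperbolic_chain_orbit R n p (fun i => P (xi i) (x i))
  (fun i => local_map (c_ i) (c_ (ordS i)) F (x i) (x (ordS i)))
  (fun i => local_map (c_ (ordS i)) (c_ i) G (x (ordS i)) (x i)) r rho rho0 rhor.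
- by move=> i; exact: splitting_chart_idem (splitE (Lx i)) (DP (xiD i)) (Lx i) (Ox i).
- by move=> i v w; exact: (ce_fwd (E1 i)).
- by move=> i v w; exact: (ce_bwd (E1 i)).
- by move=> i v w; exact: (ce_transverse (E1 i)).
- move=> i w wr; have {}wr := le_trans wr rho_1.
  by split; [exact: (co_back (E2 i))|exact: (co_cancel (E2 i))].
- move=> i; apply: le_trans (sc_boundP (DP (xiD _)) (Lx _) (Ox _) _) _.
  by rewrite -Ke ler_wpM2l//; [exact: ltW|exact: (E3 i).1].
- move=> i; apply: le_trans (sc_boundQ (DP (xiD _)) (Lx _) (Ox _) _) _.
  by rewrite -Ke ler_wpM2l//; [exact: ltW|exact: (E3 i).2].
exists (fun i => cinv (c_ i) (cfun (c_ i) (x i) + w i)) => i.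
have [wr wS] := wP i; have [_ Fdom] := ce_dom (E1 i) (le_trans wr rhor).
split; last exact: (co_close (E2 i)) (le_trans wr rho_1).
by rewrite -wS /local_map subrKC cfunK.
Qed.

End shadowing.


Section drift.
Variables (M : topologicalType) (f : M -> M).
Hypotheses (Mcompact : compact [set: M]) (Mhausdorff : hausdorff_space M).
Hypothesis cf : continuous f.

(** Over a fixed number of steps an orbit that starts near a pseudo-orbit with small
jumps stays near it. *)
Lemma pseudo_orbit_drift (W : set (M * M)) j : diag_nbhs W ->
  exists W1 V, [/\ diag_nbhs W1, diag_nbhs V & forall (Y : nat -> M) z,
    (forall i, V (f (Y i), Y i.+1)) -> W1 (z, Y 0%N) -> W (iter j f z, Y j)].
Proof.
elim: j W => [|j IH] W dW.
  by exists W, setT; split => //; exact: diag_nbhsT.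
have [W2 dW2 W2W] := diag_nbhs_comp Mcompact Mhausdorff dW.
have [W1 [V [dW1 dV H]]] := IH _ (diag_nbhs_preimage cf dW2).
exists W1, (V `&` W2); split => //; first exact: diag_nbhsI.
move=> Y z YV zY; apply: (W2W _ (f (Y j))); last exact: (YV j).2.
by apply: (H Y z) => // i; exact: (YV i).1.
Qed.

Lemma pseudo_orbit_drift_le (W : set (M * M)) m : diag_nbhs W ->
  exists W1 V, [/\ diag_nbhs W1, diag_nbhs V & forall (Y : nat -> M) z j,
    (forall i, V (f (Y i), Y i.+1)) -> W1 (z, Y 0%N) -> (j <= m)%N ->
    W (iter j f z, Y j)].
Proof.
move=> dW; elim: m => [|m [W1 [V [dW1 dV H]]]].
  exists W, setT; split => //; first exact: diag_nbhsT.
  by move=> Y z j _ ?; rewrite leqn0 => /eqP ->.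
have [W1' [V' [dW1' dV' H']]] := pseudo_orbit_drift m.+1 dW.
exists (W1 `&` W1'), (V `&` V'); split; [exact: diag_nbhsI|exact: diag_nbhsI|].
move=> Y z j YV [z1 z2]; rewrite leq_eqVlt ltnS => /predU1P[->|jm].
  by apply: (H' Y z) => // i; exact: (YV i).2.
by apply: (H Y z) => // i; exact: (YV i).1.
Qed.

End drift.

Section hyperbolic_shadowing.
Variables (R : realType) (n : nat) (M : topologicalType) (S : manifold R n M).
Variables (g : riemannian S) (r : nat) (f : diffeo S r).
Hypotheses (Mcompact : compact [set: M]) (r_ge1 : (1 <= r)%N).

Lemma dfun_strict : strict_map S f.
Proof. exact: strict_map_Cr r_ge1 (dfun_Cr f). Qed.

Lemma dinv_strict : strict_map S (Defs.dinv f).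
Proof. exact: strict_map_Cr r_ge1 (dinv_Cr f). Qed.

Lemma tangent_map_id x (v : 'rV[R]_n) : tangent_map S id x v = v.
Proof. by rewrite tangent_mapE chart_jacobian_id ?mulmx1//; exact: chart_at_dom. Qed.

Lemma linfun_tangent_map (h : M -> M) x v :
  linfun (tangent_map S h x) v = tangent_map S h x v.
Proof.
pose T := 'd (cfun (chart_at S (h x)) \o h \o cinv (chart_at S x)) (cfun (chart_at S x) x).
exact: (lfunE T v).
Qed.

Lemma iter_cancel (h h' : M -> M) k : cancel h h' -> cancel (iter k h) (iter k h').
Proof. by move=> hK x; elim: k => //= k IH; rewrite -iterS iterSr hK. Qed.

Section invariant_bundle.
Variables (L : set M) (E : M -> {vspace 'rV[R]_n}).
Hypothesis fL : forall x, L x -> L (f x).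
Hypothesis fE : forall x, L x -> (linfun (tangent_map S f x) @: E x)%VS = E (f x).

Lemma iter_invariant k x : L x -> L (iter k f x).
Proof. by elim: k => //= k IH /IH/fL. Qed.

Lemma tangent_iter_sub k x u : L x -> u \in E x ->
  tangent_map S (iter k f) x u \in E (iter k f x).
Proof.
move=> Lx; elim: k => [|k IH] uE /=; first by rewrite tangent_map_id.
rewrite (tangent_map_comp _ _ (strict_map_iter k dfun_strict) dfun_strict).
rewrite -fE; last exact: iter_invariant.
by rewrite -linfun_tangent_map memv_img// IH.
Qed.

Lemma tangent_iter_onto k x u : L x -> u \in E (iter k f x) ->
  exists2 v, v \in E x & u = tangent_map S (iter k f) x v.
Proof.
move=> Lx; elim: k u => [|k IH] u /=; first by exists u => //; rewrite tangent_map_id.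
rewrite -fE; last exact: iter_invariant.
move=> /memv_imgP[w /IH[v vE ->] ->]; exists v => //.
rewrite linfun_tangent_map.
by rewrite (tangent_map_comp _ _ (strict_map_iter k dfun_strict) dfun_strict).
Qed.

(** A vector of the bundle at the image is the image of one of the bundle at the
source, which the inverse recovers. *)
Lemma tangent_inverse_iter_sub k x u : L x -> u \in E (iter k f x) ->
  tangent_map S (iter k (Defs.dinv f)) (iter k f x) u \in E x.
Proof.
move=> Lx /(tangent_iter_onto Lx)[v vE ->].
rewrite -(tangent_map_comp _ _ (strict_map_iter k dfun_strict) (strict_map_iter k dinv_strict)).
rewrite (_ : _ \o _ = id) ?tangent_map_id//.
by apply/funext; exact: iter_cancel (dfunK f).
Qed.

End invariant_bundle.

Lemma expr_small (a e : R) : 0 < a < 1 -> 0 < e ->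
  exists2 m, (0 < m)%N & a ^+ m <= e.
Proof.
move=> /andP[a0 a1] e0; have na : `|a| < 1 by rewrite gtr0_norm.
have /cvgrPdist_le/(_ _ e0) := cvg_expr na.
move=> [N _ NP]; exists N.+1 => //.
have := NP N.+1 (leqnSn N); rewrite /= sub0r normrN => H.
exact: le_trans (ler_norm _) H.
Qed.

(** The atlas, hence [K], is fixed before the number [m] of iterations. The
pseudo-orbit is sampled every [m] steps, which keeps the period [p]; the orbit
found closes up after [p] steps of the iterate, that is [p * m] steps of [f]. *)
Lemma hyperbolic_periodic_shadowing (L : set M) : hyperbolic g f L ->
  forall W, diag_nbhs W -> exists2 V, diag_nbhs V &
    forall p (X : nat -> M), (0 < p)%N -> (forall i, L (X i)) ->
      (forall i, V (f (X i), X i.+1)) -> (forall i, X (i + p)%N = X i) ->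
      exists2 z, periodic_point f z & forall i, W (iter i f z, X i).
Proof.
move=> [cL fLeq [Es [Eu [contEs contEu splitE invE [c [lam [c0 lam01 rates]]]]]]] W dW.
have haus := manifold_hausdorff S; have clL := compact_closed haus cL.
have fL x : L x -> L (f x) by move=> Lx; rewrite -fLeq; exists x.
have fEs x : L x -> (linfun (tangent_map S f x) @: Es x)%VS = Es (f x).
  by move=> /invE[].
have fEu x : L x -> (linfun (tangent_map S f x) @: Eu x)%VS = Eu (f x).
  by move=> /invE[].
have [D [N [V [P [K [K0 DP VN Vcover]]]]]] :=
  splitting_atlas g Mcompact clL contEs contEu splitE.
have lam0 : 0 < lam by case/andP: lam01.
have cK : 0 < c * K ^+ 3 by rewrite mulr_gt0// exprn_gt0.
have q0 : 0 < 8^-1 / (c * K ^+ 3) by rewrite divr_gt0// invr_gt0.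
have [m m0 lam_m] := expr_small lam01 q0.
pose theta := c * lam ^+ m.
have theta0 : 0 <= theta by rewrite mulr_ge0 ?exprn_ge0// ltW.
have Ktheta : K ^+ 3 * theta <= 8^-1.
  have -> : K ^+ 3 * theta = lam ^+ m * (c * K ^+ 3) by rewrite /theta; ring.
  by rewrite -ler_pdivlMr.
pose F := iter m f; pose G := iter m (Defs.dinv f).
have FK : cancel F G := iter_cancel m (dfunK f).
have GK : cancel G F := iter_cancel m (Defs.dinvK f).
have sF : strict_map S F := strict_map_iter m dfun_strict.
have sG : strict_map S G := strict_map_iter m dinv_strict.
have FL x : L x -> L (F x) by move=> Lx; exact: iter_invariant.
have F_contr x u : L x -> u \in Es x ->
    tnorm g (F x) (tangent_map S F x u) <= theta * tnorm g x u.
  by move=> Lx uE; exact: (rates x Lx m).1.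
have G_contr x u : L x -> u \in Eu (F x) ->
    tnorm g x (tangent_map S G (F x) u) <= theta * tnorm g (F x) u.
  move=> Lx uE; have := (rates (F x) (FL _ Lx) m).2 u uE.
  have -> : iterz f (- m%:Z) = G by rewrite /G; case: (m) m0.
  by rewrite FK.
have [W1 [V1 [dW1 dV1 H1]]] := pseudo_orbit_drift_le Mcompact haus dfun_strict.1 m dW.
have FEs x u : L x -> u \in Es x -> tangent_map S F x u \in Es (F x).
  by move=> Lx; exact: (tangent_iter_sub fL fEs).
have FEu x u : L x -> u \in Eu x -> tangent_map S F x u \in Eu (F x).
  by move=> Lx; exact: (tangent_iter_sub fL fEu).
have GEs x u : L x -> u \in Es (F x) -> tangent_map S G (F x) u \in Es x.
  by move=> Lx; exact: (tangent_inverse_iter_sub fL fEs).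
have GEu x u : L x -> u \in Eu (F x) -> tangent_map S G (F x) u \in Eu x.
  by move=> Lx; exact: (tangent_inverse_iter_sub fL fEu).
have [U dU HU] := strong_periodic_shadowing Mcompact clL FK GK sF sG FL
  (fun x Lx => (splitE x Lx).2) FEs FEu GEs GEu
  K0 theta0 Ktheta F_contr G_contr DP VN Vcover dW1.
have [W2 [V2 [dW2 dV2 H2]]] := pseudo_orbit_drift Mcompact haus dfun_strict.1 m dU.
exists (V1 `&` V2); first exact: diag_nbhsI.
move=> p X p0 LX VX Xp.
have Xmul i q : X (i + q * p)%N = X i.
  elim: q => [|q IH]; first by rewrite mul0n addn0.
  by rewrite mulSn addnCA addnC Xp.
have Xmod i : X ((i %% p) * m)%N = X (i * m)%N.
  by rewrite {2}(divn_eq i p) mulnDl mulnAC addnC Xmul.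
have [|z zP] := HU p (fun i : 'I_p => X (i * m)%N) (fun i => LX _).
  move=> i; rewrite /= Xmod mulSn addnC -[(i * m)%N]addn0.
  have := H2 (fun j => X (i * m + j)%N) (X (i * m)%N); rewrite addn0; apply.
    by move=> j; rewrite addnS; exact: (VX _).2.
  exact: diag_nbhs_refl.
pose zz i := z (Ordinal (ltn_pmod i p0)).
have zzS i : F (zz i) = zz i.+1.
  rewrite (zP _).1; congr z; apply/val_inj => /=.
  by rewrite -addn1 modnDml addn1.
have zzE i : zz i = iter i F (zz 0%N) by elim: i => //= i <-; rewrite zzS.
have zzW i : W1 (zz i, X (i * m)%N).
  by rewrite -Xmod; exact: (zP (Ordinal (ltn_pmod i p0))).2.
exists (zz 0%N).
  exists (p * m)%N; first by rewrite muln_gt0 p0.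
  by rewrite iterM -zzE /zz; congr z; apply/val_inj; rewrite /= modnn mod0n.
move=> t; rewrite {1 2}(divn_eq t m) addnC iterD iterM -zzE addnC.
apply: (H1 (fun j => X (t %/ m * m + j)%N)).
- by move=> j; rewrite addnS; exact: (VX _).1.
- by rewrite addn0.
- by rewrite ltnW// ltn_pmod.
Qed.

End hyperbolic_shadowing.


(** * Short curves *)

Section chart_path.
Variables (R : realType) (n : nat) (M : topologicalType) (S : manifold R n M).
Variable g : riemannian S.

(** Runs from 0 to 1 on the unit interval and stays bounded on the whole line,
where curves must be defined. *)
Definition sweep (t : R) : R := sin (pi / 2 * t).
Definition sweep' (t : R) : R := cos (pi / 2 * t) * (pi / 2).

Lemma is_derive_sweep t : is_derive t (1 : R) sweep (sweep' t).
Proof.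
have tK : is_derive t (1 : R) (fun u : R => (pi / 2) *: u) (pi / 2).
  have h1 := is_deriveZ (pi / 2) (is_derive_id t (1 : R)).
  by apply: is_derive_eq h1 _; exact: mulr1.
exact: (@is_derive1_comp R (@sin R) (fun u : R => (pi / 2) *: u)).
Qed.

Lemma continuous_sweep : continuous sweep.
Proof.
move=> t; apply: (@continuous_comp _ _ _ (fun u : R => pi / 2 * u) (@sin R)).
  exact: mulrl_continuous.
exact: continuous_sin.
Qed.

Lemma continuous_sweep' : continuous sweep'.
Proof.
move=> t; have c1 : {for t, continuous (fun t : R => cos (pi / 2 * t))}.
  apply: (@continuous_comp _ _ _ (fun u : R => pi / 2 * u) (@cos R)).
    exact: mulrl_continuous.
  exact: continuous_cos.
exact: (@continuousM _ _ _ _ t c1 (@cst_continuous _ _ (pi / 2) t)).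
Qed.

Lemma sweep'_le2 t : `|sweep' t| <= 2.
Proof.
have /andP[p0 p2] := @pihalf_02 R.
rewrite normrM (gtr0_norm p0); apply: (@le_trans _ _ (1 * (pi / 2))).
  by apply: ler_wpM2r; [exact: ltW|exact: cos_max].
by rewrite mul1r ltW.
Qed.

Variables (c : chart R n M) (u w : 'rV[R]_n).
Hypothesis ac : atlas S c.
Hypothesis line_cod : forall t, ccod c (u + sweep t *: w).

Let line (t : R) : 'rV[R]_n := u + sweep t *: w.
Let gamma (t : R) : M := cinv c (line t).

Let line_continuous : continuous line.
Proof.
move=> t; apply: (@cvgD _ _ _ _ _ (cst u)); first exact: cvg_cst.
by apply: cvgZr_tmp; exact: continuous_sweep.
Qed.

Let gamma_continuous : continuous gamma.
Proof.
move=> t; apply: (@continuous_comp _ _ _ line (cinv c)); first exact: line_continuous.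
exact: cinv_continuous (line_cod t).
Qed.

Let diff_line t : differentiable line t /\ forall e : R, 'd line t e = (sweep' t * e) *: w.
Proof.
have [ds Ds] := is_derive_sweep t; have {}ds := (derivable1_diffP _ _).1 ds.
have dsE (e : R) : 'd sweep t e = sweep' t * e.
  rewrite -[e in LHS]mulr1 -[e * 1]/(e *: (1 : R)) linearZ /= -deriveE// Ds.
  exact: mulrC.
have dw : differentiable (fun z : R => sweep z *: w) t by exact: differentiableZl.
have dl : is_diff t line (fun e : R => 0 + 'd sweep t e *: w).
  apply: (@is_diffD _ _ _ (cst u) (fun z : R => sweep z *: w)).
  by apply: DiffDef => //; rewrite diffZl.
split; first exact: ex_diff.
by move=> e; rewrite diff_val add0r dsE.
Qed.

Let diff_gamma (c' : chart R n M) t : atlas S c' -> cdom c' (gamma t) ->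
  differentiable (cfun c' \o gamma) t /\ forall e : R, 'd (cfun c' \o gamma) t e =
    (sweep' t * e) *: (w *m jacobian (cfun c' \o cinv c) (line t)).
Proof.
move=> ac' cgt; have [dl lE] := diff_line t.
have [dh _] := @transition_smooth _ _ _ S c c' ac ac' 1%N.
have {}dh : differentiable (cfun c' \o cinv c) (line t).
  by apply: dh; split; [exact: line_cod|].
split; first exact: (@differentiable_comp _ _ _ _ line (cfun c' \o cinv c)).
move=> e; have := @diff_comp _ _ _ _ line (cfun c' \o cinv c) t dl dh.
move=> /(congr1 (fun F => F e)) /= ->.
by rewrite lE linearZ /= diff_jacobian.
Qed.

Lemma chart_path_C1 : C1_curve S gamma.
Proof.
split; first exact: gamma_continuous.
move=> c' ac'; split=> [t ct|e t ct]; first exact: (diff_gamma ac' ct).1.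
have cid : continuous (@id M) by move=> y; exact: cvg_id.
pose U := ccod c `&` cinv c @^-1` cdom c'.
have hC : Cr 1 U (cfun c' \o cinv c) := @transition_smooth _ _ _ S c c' ac ac' 1%N.
have Ut : U (line t) by split; [exact: line_cod|].
pose h (t : R) : 'rV[R]_n := (sweep' t * e) *: (w *m jacobian (cfun c' \o cinv c) (line t)).
have ch : {for t, continuous h}.
  have c1 : {for t, continuous (fun t : R => sweep' t * e)}.
    by apply: continuousM; [exact: continuous_sweep'|exact: cst_continuous].
  have c2 : {for t, continuous (fun t : R =>
      (w *m jacobian (cfun c' \o cinv c) (line t) : 'rV[R]_n))}.
    apply: (@continuous_comp _ _ _ line
      (fun y : 'rV[R]_n => (w *m jacobian (cfun c' \o cinv c) y : 'rV[R]_n))).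
      exact: line_continuous.
    exact: (Cr1_mulmx_jacobian (v := w) hC Ut).
  exact: (@cvgZ _ _ _ _ _ _ _ _ _ c1 c2).
pose h' (x : R) : 'rV[R]_n := 'd (cfun c' \o gamma) x e.
have near_t : \forall x \near t, h x = h' x.
  have : nbhs t (gamma @^-1` cdom c').
    by apply: gamma_continuous; apply: open_nbhs_nbhs; split=> //; exact: cdom_open.
  by apply: filterS => x cx; rewrite /h' (diff_gamma ac' cx).2.
have ch' : {for t, continuous h'}.
  move=> A; rewrite -(nbhs_singleton near_t) => /ch hA.
  by apply: filterS (filterI near_t hA) => x [E] /=; rewrite -E.
exact: ch'.
Qed.

Lemma chart_path_velocity t :
  velocity S gamma t = from_chart S c (gamma t) (sweep' t *: w).
Proof.
have ac' := chart_at_atlas S (gamma t); have cg := chart_at_dom S (gamma t).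
have [dg dE] := diff_gamma ac' cg.
have E : cfun c (gamma t) = line t by exact: (cinvK (line_cod t)).
have -> : velocity S gamma t =
    sweep' t *: (w *m jacobian (cfun (chart_at S (gamma t)) \o cinv c) (line t)).
  by rewrite /velocity derive1E deriveE// dE mulr1.
rewrite -E from_chartE chart_jacobianE -scalemxAl.
exact: erefl.
Qed.

Lemma chart_path_length (C : R) : 0 <= C ->
  (forall t v, tnorm g (gamma t) (from_chart S c (gamma t) v) <= C * `|v|) ->
  (curve_length g gamma <= (C * (2 * `|w|))%:E)%E.
Proof.
move=> C0 HC.
pose q (z : 'rV[R]_n) := inner g (cinv c z) (from_chart S c (cinv c z) w)
  (from_chart S c (cinv c z) w).
have tE t : tnorm g (gamma t) (velocity S gamma t) = `|sweep' t| * Num.sqrt (q (line t)).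
  by rewrite chart_path_velocity tnorm_from_chartZ.
have cq : continuous (fun t => `|sweep' t| * Num.sqrt (q (line t))).
  move=> t; have c1 : {for t, continuous (fun t => `|sweep' t|)}.
    apply: (@continuous_comp _ _ _ sweep' (fun x : R => `|x|)); first exact: continuous_sweep'.
    exact: norm_continuous.
  have c2 : {for t, continuous (fun t => Num.sqrt (q (line t)))}.
    apply: (@continuous_comp _ _ _ (fun t => q (line t)) Num.sqrt); last exact: sqrt_continuous.
    apply: (@continuous_comp _ _ _ line q); first exact: line_continuous.
    exact: (@inner_smooth _ _ _ _ g c ac w w 0%N _ (line_cod t)).
  exact: (@continuousM _ _ _ _ t c1 c2).
rewrite /curve_length.
have m01 : measurable (`[0%R, 1%R] : set R) by exact: measurable_itv.
apply: (@le_trans _ _ (\int[lebesgue_measure]_(t in `[0%R, 1%R]) (cst (C * (2 * `|w|))%:E t))%E).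
  apply: ge0_le_integral => //.
  - by move=> t _; rewrite lee_fin sqrtr_ge0.
  - apply/measurable_EFinP; apply: measurable_funTS.
    under eq_fun do rewrite tE.
    exact: continuous_measurable_fun.
  - move=> t _; rewrite lee_fin chart_path_velocity; apply: le_trans (HC _ _) _.
    by rewrite ler_wpM2l// normrZ ler_wpM2r// sweep'_le2.
rewrite integral_cst//.
have := @lebesgue_measure_itv R `[0%R, 1%R]; rewrite /= lte_fin ltr01 => ->.
by rewrite oppr0 adde0 mule1.
Qed.

End chart_path.

Section distance.
Variables (R : realType) (n : nat) (M : topologicalType) (S : manifold R n M).
Variable g : riemannian S.

(** Two points near [x] are joined by the segment between them in a chart, whose
length is at most a constant times the distance of their coordinates. *)
Lemma riem_dist_diag_nbhs (eps : R) : 0 < eps ->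
  diag_nbhs [set p : M * M | (riem_dist g p.1 p.2 < eps%:E)%E].
Proof.
move=> e0 x; pose c := chart_at S x; have ac : atlas S c := chart_at_atlas S x.
have cx : cdom c x := chart_at_dom S x.
have [K K0 HK] := tnorm_comparable g ac cx.
have [Q [nQ QK]] : exists Q : set M, nbhs x Q /\ forall y, Q y ->
    forall v : 'rV[R]_n, tnorm g y (from_chart S c y v) <= K * `|v|.
  by eexists; split; [exact: HK|move=> y Hy v; exact: (Hy v).2].
have : nbhs (cfun c x) (ccod c `&` cinv c @^-1` Q).
  apply: filterI; first by apply: open_nbhs_nbhs; split; [exact: ccod_open|exact: cfun_cod].
  by apply: (cinv_continuous (cfun_cod cx)); rewrite cfunK.
move=> /nbhs_ballP[d d0 dP].
pose r := Num.min (d / 4) (eps / (K * 8)).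
have r0 : 0 < r by rewrite lt_min !divr_gt0// mulr_gt0.
have rd : r <= d / 4 by rewrite ge_min lexx.
have re : r <= eps / (K * 8) by rewrite ge_min lexx orbT.
have nx : nbhs x (cdom c `&` [set y | `|cfun c y - cfun c x| <= r]).
  apply: filterI; first by apply: open_nbhs_nbhs; split => //; exact: cdom_open.
  have /cvgrPdistC_lt/(_ _ r0) := cfun_continuous cx.
  by apply: filterS => y /ltW.
exists (cdom c `&` [set y | `|cfun c y - cfun c x| <= r],
        cdom c `&` [set y | `|cfun c y - cfun c x| <= r]) => //.
move=> [y z] /= [[cy yr] [cz zr]].
set u := cfun c y in yr; pose w := cfun c z - u.
have wr : `|w| <= 2 * r.
  rewrite /w -(subrKA (cfun c x)); apply: le_trans (ler_normD _ _) _.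
  by rewrite [`|cfun c x - _|]distrC; lra.
have ball_line t : ball (cfun c x) d (u + sweep t *: w).
  rewrite -ball_normE /= distrC addrAC; apply: le_lt_trans (ler_normD _ _) _.
  have : `|sweep t *: w| <= `|w| by rewrite normrZ ler_piMl// sin_max.
  lra.
have lc t : ccod c (u + sweep t *: w) := (dP _ (ball_line t)).1.
have C1 := chart_path_C1 ac lc.
have len := chart_path_length ac lc (ltW K0) (fun t => QK _ (dP _ (ball_line t)).2).
have E0 : u + sweep 0 *: w = cfun c y by rewrite /sweep mulr0 sin0 scale0r addr0.
have E1 : u + sweep 1 *: w = cfun c z.
  by rewrite /sweep mulr1 sin_pihalf scale1r /w subrKC.
have path := piecewise_cons C1 (piecewise_nil g _).
rewrite /= E0 E1 !cfunK// in path.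
apply: le_lt_trans (ereal_inf_lbound path) _.
rewrite adde0; apply: le_lt_trans len _; rewrite lte_fin.
have : K * (2 * `|w|) <= K * (2 * (2 * r)) by rewrite !ler_wpM2l// ltW.
have : K * r <= eps / 8.
  by rewrite mulrC -ler_pdivlMr// (le_trans re)// invfM mulrA mulrAC.
lra.
Qed.

End distance.


(** * Specification *)

Section itinerary.
Variables (M : topologicalType) (f : M -> M) (B : set M) (V : set (M * M)) (N : nat).
Hypothesis dV : diag_nbhs V.
Hypothesis fB : forall x, B x -> B (f x).
(* two steps at least, so that each gap has a point strictly inside *)
Hypothesis N1 : (1 < N)%N.
Hypothesis glue : forall x y m, B x -> B y -> (N <= m)%N ->
  exists2 q, B q & V (f x, f q) /\ V (iter m f q, y).

Let iterB t x : B x -> B (iter t f x).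
Proof. by elim: t => //= t IH /IH/fB. Qed.

(** The gap between the end x of a segment and the start y of the next one is filled
with the orbit of a point q such that f q is near f x and a later iterate of q is
near y. *)
Lemma pseudo_orbit_through (k : nat) (xs : nat -> M) (s e : nat -> nat) :
  s 0%N = 0%N -> (forall j, (j <= k)%N -> B (xs j)) ->
  (forall j, (j <= k)%N -> (s j <= e j)%N) ->
  (forall j, (j < k)%N -> (e j + N <= s j.+1)%N) ->
  exists X : nat -> M, [/\ forall t, (t <= e k)%N -> B (X t),
    forall t, (t < e k)%N -> V (f (X t), X t.+1) &
    forall j t, (j <= k)%N -> (t <= e j - s j)%N -> X (s j + t)%N = iter t f (xs j)].
Proof.
move=> s0; elim: k => [|k IH] Bx se es.
  exists (fun t => iter t f (xs 0%N)); split.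
  - by move=> t _; apply: iterB; exact: Bx.
  - by move=> t _ /=; exact: diag_nbhs_refl.
  - by move=> j t; rewrite leqn0 => /eqP -> _; rewrite s0.
have [||j|X [XB XV XE]] := IH; first by move=> j jk; apply: Bx; exact: leqW.
  by move=> j jk; apply: se; exact: leqW.
  by move=> jk; apply: es; exact: leqW.
have sk := es k (ltnSn k); have sk1 := se k.+1 (leqnn _).
have km : (N <= s k.+1 - e k)%N by lia.
have [q Bq [Vq qV]] := glue (XB _ (leqnn (e k))) (Bx k.+1 (leqnn _)) km.
pose Y t := if (t <= e k)%N then X t else
  if (t < s k.+1)%N then iter (t - e k) f q else iter (t - s k.+1) f (xs k.+1).
have e_mono j i : (j <= i)%N -> (i <= k)%N -> (e j <= e i)%N.
  elim: i => [|i IHi]; first by rewrite leqn0 => /eqP ->.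
  rewrite leq_eqVlt => /predU1P[-> //|ji ik].
  have := IHi ji (ltnW ik); have := es i (leqW ik); have := se i.+1 (leqW ik); lia.
have YL t : (t <= e k)%N -> Y t = X t by rewrite /Y => ->.
have YM t : (e k < t)%N -> (t < s k.+1)%N -> Y t = iter (t - e k) f q.
  by rewrite /Y => h1 ->; rewrite leqNgt h1.
have YR t : (s k.+1 <= t)%N -> Y t = iter (t - s k.+1) f (xs k.+1).
  by move=> h; rewrite /Y leqNgt (_ : (e k < t)%N) ?ltnNge ?h//; lia.
exists Y; split.
- move=> t te; rewrite /Y; case: ifPn => [/XB//|_].
  by case: ifP => _; apply: iterB => //; exact: Bx.
- move=> t te; have [tk|kt] := ltnP t (e k).
    by rewrite !YL ?(ltnW tk)//; exact: XV.
  have [ts|st] := ltnP t (s k.+1); last first.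
    rewrite !YR ?(leqW st)// subSn// iterS; exact: diag_nbhs_refl.
  have [tE|tk] := eqVneq t (e k).
    rewrite tE YL// YM//; last by lia.
    by rewrite subSnn.
  have {}kt : (e k < t)%N by lia.
  rewrite (YM t)//; have [ts'|st'] := ltnP t.+1 (s k.+1).
    rewrite YM ?(leqW kt)// subSn ?(ltnW kt)// iterS; exact: diag_nbhs_refl.
  have tE : t.+1 = s k.+1 by lia.
  rewrite YR// tE subnn -iterS -subSn ?(ltnW kt)// tE; exact: qV.
- move=> j t; rewrite leq_eqVlt ltnS => /predU1P[-> tle|jk tle].
    by rewrite YR ?leq_addr// addKn.
  have h0 := XE j t jk tle; have h1 := e_mono j k jk (leqnn k); have h2 := se j (leqW jk).
  by rewrite -h0 YL//; lia.
Qed.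

End itinerary.

Section integer_iterates.
Variables (R : realType) (n : nat) (M : topologicalType) (S : manifold R n M).
Variables (r : nat) (f : diffeo S r).

Lemma iterzS (a : int) x : iterz f (a + 1) x = f (iterz f a x).
Proof.
case: a => [k|[|k]]; first by rewrite -PoszD addn1.
  by rewrite /= Defs.dinvK.
by rewrite (_ : Negz k.+1 + 1 = Negz k); [rewrite /= Defs.dinvK|lia].
Qed.

Lemma iterzD (a b : int) x : iterz f (a + b) x = iterz f a (iterz f b x).
Proof.
have f_inj : injective f := can_inj (dfunK f).
elim/int_rect: a => [|k IH|k IH]; first by rewrite add0r.
  by rewrite intS [1 + _]addrC addrAC !iterzS IH.
apply: f_inj; rewrite -!iterzS.
have -> : - k.+1%:Z + b + 1 = - k%:Z + b by lia.
by have -> : - k.+1%:Z + 1 = - k%:Z by lia.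
Qed.

Lemma iterz_invariant (B : set M) (a : int) x : f @` B = B -> B x -> B (iterz f a x).
Proof.
move=> fBB; have fB y : B y -> B (f y) by move=> By; rewrite -fBB; exists y.
have iB y : B y -> B (Defs.dinv f y) by rewrite -{1}fBB => -[w Bw <-]; rewrite dfunK.
have iter_in (h : M -> M) k : (forall y, B y -> B (h y)) -> B x -> B (iter k h x).
  by move=> hB Bx; elim: k => //= k; exact: hB.
by case: a => k; exact: iter_in.
Qed.

Lemma iterz_periodic (a : int) x : periodic_point f x -> periodic_point f (iterz f a x).
Proof.
move=> [p p0 px]; exists p => //.
have iterE y : iter p f y = iterz f p%:Z y by [].
by rewrite iterE -iterzD addrC iterzD -iterE px.
Qed.

End integer_iterates.

Lemma periodic_nonwandering (M : topologicalType) (f : M -> M) :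
  periodic_point f `<=` nonwandering f.
Proof.
move=> z [p p0 pz] U Uo Uz; exists p => //.
by exists z; split => //; exists z.
Qed.

Section specification.
Variables (R : realType) (n : nat) (M : topologicalType) (S : manifold R n M).
Variables (g : riemannian S) (r : nat) (f : diffeo S r) (B : set M).
Hypotheses (Mcompact : compact [set: M]) (r_ge1 : (1 <= r)%N).
Hypotheses (fA : axiomA g f) (fB : basic_set f B) (fmix : mixing_on f B).

(** A periodic point is nonwandering, and the other basic sets are finitely many
closed sets disjoint from [B]. *)
Lemma periodic_near_basic : exists2 W : set (M * M), diag_nbhs W &
  forall z x, periodic_point f z -> B x -> W (z, x) -> B z.
Proof.
have [P [Pfin Ptriv Pcov PP] PB] := fB.
pose C := \bigcup_(A in P `\ B) A.
have clC : closed C.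
  apply: closed_bigcup; first exact: sub_finite_set Pfin.
  by move=> A [/PP[]].
have clB : closed B by have [] := PP B PB.
have BC x : B x -> ~ C x.
  move=> Bx [A [PA AB] Ax]; apply: AB => /=.
  by apply: (Ptriv A B PA PB); exists x.
exists [set p | B p.2 -> ~ C p.1].
  move=> x; have [Cx|nCx] := pselect (C x).
    exists (setT, ~` B) => /=.
      split; first exact: filterT.
      apply: open_nbhs_nbhs; split; first by rewrite openC.
      by move=> Bx; exact: BC Bx Cx.
    by move=> [a b] /= [_ nBb] /nBb.
  exists (~` C, setT) => /=.
    split; last exact: filterT.
    by apply: open_nbhs_nbhs; split; [rewrite openC|].
  by move=> [a b] /= [].
move=> z x /periodic_nonwandering; rewrite -Pcov => -[A PA Az] Bx /(_ Bx) nC.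
have [<-//|AB] := pselect (A = B).
by case: nC; exists A.
Qed.

(** Times are counted from the start of the first segment, so that they are natural
numbers. *)
Lemma basic_specification (eps : R) : 0 < eps -> exists N : nat,
  forall (k : nat) (xs : nat -> M) (s e : nat -> nat),
    s 0%N = 0%N -> (forall j, (j <= k)%N -> B (xs j)) ->
    (forall j, (j <= k)%N -> (s j <= e j)%N) ->
    (forall j, (j < k)%N -> (e j + N <= s j.+1)%N) ->
  exists z, [/\ B z, periodic_point f z &
    forall j t, (j <= k)%N -> (t <= e j - s j)%N ->
      (riem_dist g (iter (s j + t) f z) (iter t f (xs j)) < eps%:E)%E].
Proof.
move=> eps0; have [P [Pfin Ptriv Pcov PP] PB] := fB.
have [_ _ fBB _] := PP B PB.
have fBin x : B x -> B (f x) by move=> Bx; rewrite -fBB; exists x.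
have haus := manifold_hausdorff S.
have BL : B `<=` nonwandering f by move=> x Bx; rewrite -Pcov; exists B.
have cf : continuous f := (dfun_Cr f).1.
have [W0 dW0 W0B] := periodic_near_basic.
have dW := diag_nbhsI (riem_dist_diag_nbhs g eps0) dW0.
have [V dV HV] := hyperbolic_periodic_shadowing Mcompact r_ge1 fA.1 dW.
have [N HN] := mixing_uniform Mcompact haus fmix
  (diag_nbhsI dV (diag_nbhs_preimage cf dV)).
exists N.+2 => k xs s e s0 Bx se es.
have glue x y m : B x -> B y -> (N.+2 <= m)%N ->
    exists2 q, B q & V (f x, f q) /\ V (iter m f q, y).
  move=> Bx' By Nm; have [|q Bq [[_ q1] [q2 _]]] := HN x y m Bx' By.
    exact: leq_trans (ltnW (leqnSn _)) Nm.
  by exists q.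
(* one more segment, reduced to the first point, closes the pseudo-orbit up *)
pose p := (e k + N.+2)%N.
pose xs' j := if (j <= k)%N then xs j else xs 0%N.
pose s' j := if (j <= k)%N then s j else p.
pose e' j := if (j <= k)%N then e j else p.
have [||j jk|j jk|X [XB XV XE]] := @pseudo_orbit_through M f B V N.+2 dV fBin isT glue
  k.+1 xs' s' e'.
- by [].
- by move=> j _; rewrite /xs'; case: ifP => jk; exact: Bx.
- by rewrite /s' /e'; case: ifP => // jk'; exact: se.
- have jk' : (j <= k)%N by [].
  rewrite /s' /e' jk'; have [jl|kj] := ltnP j k; first exact: es.
  by have -> : j = k by lia.
have e'p : e' k.+1 = p by rewrite /e' ltnn.
rewrite e'p in XB XV.
have p0 : (0 < p)%N by rewrite /p addnS.
have X0 : X 0%N = xs 0%N.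
  by have := XE 0%N 0%N isT isT; rewrite addn0 /s' /xs' /= s0.
have Xp : X p = xs 0%N.
  by have := XE k.+1 0%N (leqnn _) isT; rewrite addn0 /s' /xs' ltnn.
have XS t : V (f (X (t %% p)%N), X (t.+1 %% p)%N).
  have tp := ltn_pmod t p0; have := XV _ tp.
  have -> : (t.+1 %% p = (t %% p).+1 %% p)%N by rewrite -addn1 -modnDml addn1.
  have [tl|pt] := ltnP (t %% p).+1 p; first by rewrite (modn_small tl).
  have -> : (t %% p).+1 = p by lia.
  by rewrite modnn Xp X0.
have [||z zper zW] := HV p (fun t => X (t %% p)%N) p0 _ XS.
- by move=> t; apply: BL; apply: XB; rewrite ltnW// ltn_pmod.
- by move=> t; rewrite modnDr.
exists z; split => //.
  apply: (W0B z (xs 0%N)) => //; first exact: Bx.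
  by have := (zW 0%N).2; rewrite mod0n X0.
move=> j t jk tle.
have ek : (s j + t < p)%N.
  have ej i : (j <= i)%N -> (i <= k)%N -> (e j <= e i)%N.
    elim: i => [|i IHi]; first by rewrite leqn0 => /eqP ->.
    rewrite leq_eqVlt => /predU1P[-> //|ji ik].
    have := IHi ji (ltnW ik); have := es i ik; have := se i.+1 ik; lia.
  have := ej k jk (leqnn k).
  have := se j jk; rewrite /p; lia.
have := (zW (s j + t)%N).1; rewrite /= modn_small//.
by have := XE j t (leqW jk); rewrite /s' /e' /xs' jk => ->.
Qed.

End specification.

Theorem proposition7p9 (R : realType) (n : nat) (M : topologicalType)
    (S : manifold R n M) (g : riemannian S) (r : nat) (f : diffeo S r)
    (B : set M)
    (M_compact : compact [set: M])
    (r_ge1 : (1 <= r)%N)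
    (f_axiomA : axiomA g f)
    (B_basic : basic_set f B)
    (B_mixing : mixing_on f B) :
  forall eps : R, 0 < eps ->
  exists N : nat,
  forall (k : nat) (x : 'I_k -> M) (a b : 'I_k -> int),
    (forall j, B (x j)) ->
    (forall j, a j <= b j) ->
    (forall j j' : 'I_k, j' = j.+1 :> nat -> N%:Z <= a j' - b j) ->
  exists y : M,
    [/\ B y,
        (forall (j : 'I_k) (i : int), 0 <= i <= b j - a j ->
           (riem_dist g (iterz f (a j + i) y) (iterz f i (x j)) < eps%:E)%E) &
        periodic_point f y].
Proof.
move=> eps eps0.
have [N HN] := basic_specification M_compact r_ge1 f_axiomA B_basic B_mixing eps0.
(* without segments, any periodic point of B will do *)
exists N => -[|k] x a b Bx ab gap.
  have [P [_ _ _ PP] PB] := B_basic; have [[x0 Bx0] _ _ _] := PP B PB.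
  have [||||z [Bz zper _]] := HN 0%N (fun=> x0) (fun=> 0%N) (fun=> 0%N) => //.
  by exists z; split => // -[].
have [P [_ _ _ PP] PB] := B_basic; have [_ _ fBB _] := PP B PB.
pose a0 := a ord0.
pose s j := `|(a (inord j) - a0)%R|%N; pose e j := `|(b (inord j) - a0)%R|%N.
have gap' j : (j < k)%N -> N%:Z <= a (inord j.+1) - b (inord j).
  by move=> jk; apply: gap; rewrite !inordK// ltnS ltnW.
have a_ge j : (j <= k)%N -> a0 <= a (inord j).
  elim: j => [|j IH] jk.
    by rewrite /a0 (_ : inord 0 = ord0)//; apply/val_inj; rewrite /= inordK.
  have := IH (ltnW jk); have := gap' j jk; have := ab (inord j); lia.
have sE j : (j <= k)%N -> a (inord j) = a0 + (s j)%:Z.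
  by move=> jk; have := a_ge j jk; rewrite /s; lia.
have eE j : (j <= k)%N -> b (inord j) = a0 + (e j)%:Z.
  by move=> jk; have := a_ge j jk; have := ab (inord j); rewrite /e; lia.
have [||j jk|j jk|z [Bz zper zP]] := HN k (fun j => x (inord j)) s e.
- rewrite /s /a0 (_ : inord 0 = ord0) ?subrr//.
  by apply/val_inj; rewrite /= inordK.
- by move=> j _; exact: Bx.
- by have := ab (inord j); rewrite sE// eE//; lia.
- by have := gap' j jk; rewrite sE// eE ?(ltnW jk)//; lia.
exists (iterz f (- a0) z); split.
- exact: iterz_invariant.
- move=> j i; have jk : (j <= k)%N by rewrite -ltnS.
  have := sE j jk; have := eE j jk; rewrite inord_val => -> ->.
  case: i => [t|t]; last by [].
  move=> /andP[_ tle]; rewrite -iterzD.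
  rewrite (_ : a0 + (s j)%:Z + t%:Z + - a0 = (s j + t)%N%:Z); last by lia.
  have := zP j t jk; rewrite inord_val; apply; lia.
- exact: iterz_periodic.
Qed.
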